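(* Let $d\ge3$, let $I\subset\mathbb{R}$ be a compact interval, let $\gamma:I\to\mathbb{R}^d$ be a $C^\infty$ curve and let $\chi\in C^\infty$ be supported in the interior of $I$. Suppose that $\gamma$ is either of finite type, or polynomial. Assume that $\gamma'(t),\dots,\gamma^{(K)}(t)$ are linearly independent for every $t\in I$. Then for $R\ge2$ the following holds. (i) If $K=d$ then $$G_q(R)\le C_qR^{-\sigma_d(q)},\quad q\ge2,\ q\notin\{q_k:k=2,\dots,d-1\},$$ and $$G_q(R)\lesssim R^{-\sigma_d(q)}\log^{1/q}(R),\quad q\in\{q_k:k=2,\dots,d-1\}.$$ (ii) If $2\le K\le d-1$ then $$G_q(R)\le C_qR^{-\sigma_K(q)},\quad q\ge2,\ q\notin\{q_k:k=2,\dots,K\},$$ and $$G_q(R)\lesssim R^{-\sigma_K(q)}\log^{1/q}(R),\quad q\in\{q_k:k=2,\dots,K\}.$$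
   Context: For $\gamma$ and $\chi$ as in the claim, let $\widehat\mu(\xi)=\int e^{-i\langle\xi,\gamma(t)\rangle}\chi(t)\,dt$ for $\xi\in\mathbb{R}^d$, the Fourier transform of the measure $\mu$ given by $\langle\mu,f\rangle=\int f(\gamma(t))\chi(t)\,dt$. Put $$G_q(R)=\Big(\int_{S^{d-1}}|\widehat\mu(R\omega)|^q\,d\omega\Big)^{1/q},$$ where $d\omega$ is the rotation invariant measure on $S^{d-1}$ induced by Lebesgue measure in $\mathbb{R}^d$. The curve $\gamma$ is of finite type if for every $s\in I$ and every $\theta\in S^{d-1}$ there is $n\ge1$ with $\langle\gamma^{(n)}(s),\theta\rangle\ne0$; by compactness there are then an integer $L\ge d$ and $c>0$ such that $\sum_{n=1}^L|\langle\gamma^{(n)}(s),\theta\rangle|\ge c$ for all $s\in I$, $\theta\in S^{d-1}$. The curve is polynomial if all its coordinate functions are polynomials. For integers $k\ge1$ set $q_k=\frac{k^2+k+2}{2}$. For $1\le q\le\infty$ define $$\sigma_K(q)\equiv\sigma_K^d(q)=\begin{cases}\displaystyle\min_{k=2,\dots,d}\Big\{\frac1k+\frac{k^2-k-2}{2kq}\Big\}, & K=d,\\[2mm] \displaystyle\min\Big\{\frac Kq,\ \min_{k=2,\dots,K}\Big(\frac1k+\frac{k^2-k-2}{2kq}\Big)\Big\}, & 2\le K<d.\end{cases}$$ The notation $a\lesssim b$ means $a\le Cb$ with $C$ independent of $R$. The constants $C$, $C_q$ may depend on $\gamma$ and $\chi$; $C_q$ also depends on $q$ (and may blow up as $q\to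 q_k$). *)

(* Defs.v *)
From HB Require Import structures.
From mathcomp Require Import all_boot all_order all_algebra.
From mathcomp Require Import complex.
From mathcomp Require Import all_classical all_reals all_analysis.
From mathcomp Require Import measurable_realfun.

Set Implicit Arguments.
Unset Strict Implicit.
Unset Printing Implicit Defensive.

Import Order.TTheory GRing.Theory Num.Theory.
Import numFieldNormedType.Exports.

Local Open Scope classical_set_scope.
Local Open Scope ring_scope.

Definition dotp (R : realType) (d : nat) (u v : 'rV[R]_d) : R :=
  \sum_(i < d) u ord0 i * v ord0 i.

(* The library norm on ['rV[R]_d] is the sup norm. *)
Definition enorm (R : realType) (d : nat) (u : 'rV[R]_d) : R :=
  Num.sqrt (dotp u u).

Definition sphere (R : realType) (d : nat) : set 'rV[R]_d :=
  [set u | enorm u = 1].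

Definition measure_rV_display : measure_display.
Proof. exact: default_measure_display. Qed.

Section rV_measurable.
Context (R : realType) (n : nat).

Definition rV_coord (i : 'I_n) (v : 'rV[R]_n) : measurableTypeR R := v ord0 i.

Let rV_set0 : g_sigma_preimage rV_coord set0.
Proof. exact: sigma_algebra0. Qed.

Let rV_setC A : g_sigma_preimage rV_coord A -> g_sigma_preimage rV_coord (~` A).
Proof. exact: sigma_algebraC. Qed.

Let rV_bigcup (F : (set _)^nat) : (forall i, g_sigma_preimage rV_coord (F i)) ->
  g_sigma_preimage rV_coord (\bigcup_i (F i)).
Proof. exact: sigma_algebra_bigcup. Qed.

HB.instance Definition _ := @isMeasurable.Build measure_rV_display
  'rV[R]_n (g_sigma_preimage rV_coord) rV_set0 rV_setC rV_bigcup.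

End rV_measurable.

Section rV_measurable_fun.
Context (R : realType) (n : nat).

Lemma measurable_rV_coord (i : 'I_n) :
  measurable_fun [set: 'rV[R]_n] (fun v => v ord0 i).
Proof.
move=> _ Y mY; rewrite setTI; apply: sub_sigma_algebra => /=.
rewrite -bigcup_seq/=; exists i => /=; first by rewrite mem_index_enum.
by exists Y => //; rewrite setTI.
Qed.

Lemma measurable_fun_rV d (T : measurableType d) (f : T -> 'rV[R]_n) :
  (forall i, measurable_fun [set: T] (fun x => f x ord0 i)) ->
  measurable_fun [set: T] f.
Proof.
move=> mf; pose G := \big[setU/set0]_(i < n)
  preimage_set_system setT (@rV_coord R n i) measurable.
suff GT : preimage_set_system setT f G `<=` measurable.
  exact: (measurability G erefl GT).
move=> _ [B + <-]; rewrite /G -bigcup_seq/= => -[i _ [C mC <-]].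
by have := mf i measurableT C mC; rewrite !setTI.
Qed.

Lemma measurable_dotp d (T : measurableType d) (f g : T -> 'rV[R]_n) :
  measurable_fun [set: T] f -> measurable_fun [set: T] g ->
  measurable_fun [set: T] (fun x => dotp (f x) (g x)).
Proof.
move=> mf mg; apply: measurable_sum => i; apply: measurable_funM.
- exact: (measurableT_comp (measurable_rV_coord i) mf).
- exact: (measurableT_comp (measurable_rV_coord i) mg).
Qed.

Lemma measurable_enorm : measurable_fun [set: 'rV[R]_n] (@enorm R n).
Proof.
apply: (@measurableT_comp _ _ _ _ _ _ (@Num.sqrt R)).
  by apply: continuous_measurable_fun; exact: sqrt_continuous.
by apply: measurable_dotp; exact: measurable_id.
Qed.

Definition normalize (v : 'rV[R]_n) : 'rV[R]_n := (enorm v)^-1 *: v.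

Lemma measurable_normalize : measurable_fun setT normalize.
Proof.
apply: measurable_fun_rV => i.
have -> : (fun x => normalize x ord0 i) =
    (fun x => (enorm x) `^ (-1) * x ord0 i).
  by apply/funext => x; rewrite /normalize mxE powR_inv1// sqrtr_ge0.
apply: measurable_funM; last exact: measurable_rV_coord.
apply: (@measurableT_comp _ _ _ _ _ _ (fun x : R => x `^ (-1))).
  exact: measurable_powR.
exact: measurable_enorm.
Qed.

Definition punctured_ball : set 'rV[R]_n := [set v | 0 < enorm v <= 1].

Lemma measurable_punctured_ball : measurable punctured_ball.
Proof.
have -> : punctured_ball = @enorm R n @^-1` `]0, 1].
  by apply/seteqP; split => v; rewrite /= in_itv.
by rewrite -[X in measurable X]setTI; exact: measurable_enorm.
Qed.

End rV_measurable_fun.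

Section lebesgue_rV.
Context (R : realType).

(* ['rV_n.+1] and ['rV_(1 + n)] are convertible. *)
Definition rV_cons n (xv : R * 'rV[R]_n) : 'rV[R]_n.+1 :=
  row_mx (xv.1%:M : 'rV_1) xv.2.

Definition rV_uncons n (v : 'rV[R]_n.+1) : R * 'rV[R]_n :=
  (v ord0 ord0, rsubmx (v : 'rV_(1 + n))).

Lemma rV_consK n : cancel (@rV_cons n) (@rV_uncons n).
Proof.
case=> x v; rewrite /rV_uncons /rV_cons/= row_mxKr; congr pair.
transitivity (row_mx (x%:M : 'rV_1) v ord0 (lshift n ord0)).
  by apply: (congr1 (row_mx (x%:M : 'rV_1) v ord0)); exact: val_inj.
by rewrite row_mxEl mxE eqxx mulr1n.
Qed.

Lemma measurable_rV_cons n :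
  measurable_fun [set: measurableTypeR R * 'rV[R]_n] (@rV_cons n).
Proof.
apply: measurable_fun_rV => i; rewrite -(splitK (i : 'I_(1 + n))).
case: (fintype.split (i : 'I_(1 + n))) => j /=.
- have -> : (fun x : R * 'rV[R]_n => rV_cons x ord0 (lshift n j)) = fst.
    apply/funext => x; apply: etrans (row_mxEl _ _ _ _) _.
    by rewrite mxE (ord1 j) eqxx mulr1n.
  exact: measurable_fst.
- have -> : (fun x : R * 'rV[R]_n => rV_cons x ord0 (rshift 1 j)) =
      (fun x => x.2 ord0 j).
    by apply/funext => x; exact: row_mxEr.
  exact: (measurableT_comp (measurable_rV_coord j) measurable_snd).
Qed.

Lemma measurable_rV_uncons n : measurable_fun [set: 'rV[R]_n.+1]
  (@rV_uncons n : _ -> measurableTypeR R * 'rV[R]_n).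
Proof.
apply: measurable_fun_pair; first exact: measurable_rV_coord.
apply: measurable_fun_rV => i.
have -> : (fun x : 'rV[R]_n.+1 => rsubmx (x : 'rV_(1 + n)) ord0 i) =
    (fun x : 'rV[R]_n.+1 => x ord0 (rshift 1 i : 'I_n.+1)).
  by apply/funext => x; rewrite mxE.
exact: measurable_rV_coord.
Qed.

Section step.
Context (n : nat) (mu : {sigma_finite_measure set 'rV[R]_n -> \bar R}).

Definition lebesgue_cons : set 'rV[R]_n.+1 -> \bar R :=
  pushforward (@lebesgue_measure R \x mu)%E (@rV_cons n).

Let lebesgue_cons0 : lebesgue_cons set0 = 0%E.
Proof. by rewrite /lebesgue_cons /pushforward preimage_set0 measure0. Qed.

Let lebesgue_cons_ge0 A : (0 <= lebesgue_cons A)%E.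
Proof. exact: (measure_ge0 (@lebesgue_measure R \x mu)%E). Qed.

Let lebesgue_cons_sigma_additive : semi_sigma_additive lebesgue_cons.
Proof.
apply: (@measure_semi_sigma_additive _ _ _
  (pushforward (@lebesgue_measure R \x mu)%E (@rV_cons n))).
exact: measurable_rV_cons.
Qed.

HB.instance Definition _ := isMeasure.Build _ _ _ lebesgue_cons
  lebesgue_cons0 lebesgue_cons_ge0 lebesgue_cons_sigma_additive.

Let lebesgue_cons_sigma_finite : sigma_finite setT lebesgue_cons.
Proof.
have /sigma_finiteP[F [TF ndF Foo]] := sigma_finiteT (@lebesgue_measure R).
have /sigma_finiteP[G [TG ndG Goo]] := sigma_finiteT mu.
exists (fun n => @rV_uncons _ @^-1` (F n `*` G n)).
  rewrite -preimage_bigcup -(preimage_setT (@rV_uncons n)); congr (_ @^-1` _).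
  apply/seteqP; split => // -[x y] _.
  have [i _ Fi] : (\bigcup_n F n) x by rewrite -TF.
  have [j _ Gj] : (\bigcup_n G n) y by rewrite -TG.
  exists (maxn i j) => //; split.
  - by move: x Fi; apply/subsetPset/ndF; exact: leq_maxl.
  - by move: y Gj; apply/subsetPset/ndG; exact: leq_maxr.
move=> k; have [mF Fk] := Foo k; have [mG Gk] := Goo k; split.
  rewrite -[X in measurable X]setTI; apply: measurable_rV_uncons => //.
  exact: measurableX.
rewrite /lebesgue_cons /pushforward -comp_preimage.
rewrite (_ : _ \o _ = id); last by apply/funext; exact: rV_consK.
by rewrite [ltLHS]product_measure1E// lte_mul_pinfty// ge0_fin_numE//.
Qed.

HB.instance Definition _ := Measure_isSigmaFinite.Build _ _ _ lebesgue_cons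
  lebesgue_cons_sigma_finite.

End step.

Fixpoint lebesgue_rV n : {sigma_finite_measure set 'rV[R]_n -> \bar R} :=
  if n is m.+1 then lebesgue_cons (lebesgue_rV m)
  else \d_(0 : 'rV[R]_0).

End lebesgue_rV.

Section sphere_measure.
Context (R : realType) (d : nat).

(* Surface measure of the unit sphere, obtained from Lebesgue measure as [d]
   times the volume of the cone over [A] in the unit ball.  It is a measure on
   ['rV[R]_d] that gives measure [0] to the complement of [sphere R d]. *)
Definition sphere_measure (A : set 'rV[R]_d) : \bar R :=
  (d%:R%:E * @lebesgue_rV R d (@punctured_ball R d `&` @normalize R d @^-1` A))%E.

Let sphere_measure0 : sphere_measure set0 = 0%E.
Proof. by rewrite /sphere_measure preimage_set0 setI0 measure0 mule0. Qed.

Let sphere_measure_ge0 A : (0 <= sphere_measure A)%E.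
Proof. by rewrite /sphere_measure mule_ge0// lee_fin. Qed.

Let sphere_measure_sigma_additive : semi_sigma_additive sphere_measure.
Proof.
move=> F mF tF _.
pose cone i := @punctured_ball R d `&` @normalize R d @^-1` F i.
have mcone i : measurable (cone i).
  apply: measurableI; first exact: measurable_punctured_ball.
  by rewrite -[X in measurable X]setTI; exact: measurable_normalize.
have tcone : trivIset setT cone.
  apply/trivIsetP => i j _ _ ij; move/trivIsetP: tF => /(_ i j Logic.I Logic.I ij) Fij.
  by rewrite /cone setIACA -preimage_setI Fij preimage_set0 setI0.
rewrite /sphere_measure preimage_bigcup setI_bigcupr.
under eq_fun do rewrite -ge0_sume_distrr//.
apply: cvgeZl => //; apply: measure_semi_sigma_additive => //.
exact: bigcupT_measurable.
Qed.

HB.instance Definition _ := isMeasure.Build _ _ _ sphere_measure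
  sphere_measure0 sphere_measure_ge0 sphere_measure_sigma_additive.

End sphere_measure.

Section curves.
Context (R : realType).

Definition diff_quotient (V : normedModType R) (f : R -> V) (t s : R) : V :=
  (s - t)^-1 *: (f s - f t).

(* Derivative relative to [I]: it only depends on the values of [f] on [I],
   and is one-sided at the end points when [I] is a compact interval. *)
Definition derive_on (V : normedModType R) (I : set R) (f : R -> V) (t : R)
    : V :=
  lim (diff_quotient f t s @[s --> within I t^']).

Definition deriven_on (V : normedModType R) (I : set R) (n : nat)
    (f : R -> V) : R -> V :=
  iter n (derive_on I) f.

Definition smooth_on (V : normedModType R) (I : set R) (f : R -> V) : Prop :=
  forall (n : nat) (t : R), I t ->
    cvg (diff_quotient (deriven_on I n f) t s @[s --> within I t^']).

Definition finite_type (d : nat) (I : set R) (gamma : R -> 'rV[R]_d) : Prop :=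
  forall s theta, I s -> sphere theta ->
    exists2 n, (1 <= n)%N & dotp (deriven_on I n gamma s) theta != 0.

Definition polynomial_curve (d : nat) (I : set R) (gamma : R -> 'rV[R]_d)
    : Prop :=
  exists p : 'I_d -> {poly R},
    forall t j, I t -> gamma t ord0 j = (p j).[t].

Definition smooth_cplx (chi : R -> R[i]) : Prop :=
  forall (n : nat) (t : R),
    derivable (derive1n n (fun s => complex.Re (chi s))) t 1 /\
    derivable (derive1n n (fun s => complex.Im (chi s))) t 1.

Definition expi (x : R) : R[i] := Complex (cos x) (sin x).

Definition cintegral (D : set R) (f : R -> R[i]) : R[i] :=
  Complex (\int[lebesgue_measure]_(t in D) complex.Re (f t))
          (\int[lebesgue_measure]_(t in D) complex.Im (f t)).

Definition fourier (d : nat) (I : set R) (gamma : R -> 'rV[R]_d)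
    (chi : R -> R[i]) (xi : 'rV[R]_d) : R[i] :=
  cintegral I (fun t => expi (- dotp xi (gamma t)) * chi t).

(* [G I gamma chi q r] is $G_q(r)$; for [q = +oo] the $L^q$ norm is the
   essential supremum. *)
Definition G (d : nat) (I : set R) (gamma : R -> 'rV[R]_d)
    (chi : R -> R[i]) (q : \bar R) (r : R) : \bar R :=
  Lnorm (@sphere_measure R d) q
    (fun omega => (ComplexField.Normc.normc
                     (fourier I gamma chi (r *: omega)))%:E).

Definition q_ (k : nat) : R := (k ^ 2 + k + 2)%:R / 2.

Definition critical (n : nat) : set (\bar R) :=
  [set (q_ k)%:E | k in [set k | (2 <= k <= n)%N]].

(* $1/q$, equal to $0$ for [q = +oo]. *)
Definition recip (q : \bar R) : R := fine q^-1%E.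

Definition sigma_term (k : nat) (q : \bar R) : R :=
  k%:R^-1 + ((k%:R ^+ 2 - k%:R - 2) / (2 * k%:R)) * recip q.

(* Minimum over $2 \le k \le K$, for $K \ge 2$. *)
Definition min_sigma_term (K : nat) (q : \bar R) : R :=
  \big[Num.min/sigma_term 2 q]_(3 <= k < K.+1) sigma_term k q.

Definition sigma (d K : nat) (q : \bar R) : R :=
  if K == d then min_sigma_term d q
  else Num.min (K%:R * recip q) (min_sigma_term K q).

End curves.

(* Main.v *)
(** Let Phi(t) = R <gamma(t), omega>.  A van der Corput argument shows that
    |mu^(R omega)| <= C / lam unless some point s has |Phi^(k)(s)| <= lam^k for
    all k up to a fixed order L >= K; Taylor's formula then gives
    |<gamma^(k)(t), omega>| <= C lam^k / R for k <= K and |t - s| <= 1 / lam.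
    Only finite type (or polynomiality, for which a high derivative of Phi
    vanishes) is used in this step.

    Linear independence enters through the measure of the exceptional set: for
    m <= K and fixed t these inequalities with k <= m confine omega to m slabs
    with normals gamma'(t), ..., gamma^(m)(t), a set of measure at most
    C R^-m lam^(1 + ... + m).  Since t may be restricted to a grid of spacing
    about 1 / lam, the set where |mu^(R omega)| > C / lam has measure at most
    C R^-m lam^(q_m).  If K = d all slabs together miss the sphere once
    lam^d << R, so that |mu^(R omega)| <= C R^(-1/d).

    It remains to sum lam^-q R^-m lam^(q_m) over dyadic lam, choosing m at each
    level.  For q_(k-1) < q < q_k one takes m = k - 1 or m = k according to
    whether lam^k exceeds R, and both sums are geometric with largest term at
    lam = R^(1/k), which gives R^(-q sigma).  For q = q_k the terms with m = k
    are all equal, whence the logarithm.  For q above the last exceptional value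
    one takes the largest m throughout and the smallest lam dominates. *)

Require Import Defs.
From mathcomp Require Import all_boot all_order all_algebra.
From mathcomp Require Import complex.
From mathcomp Require Import all_classical all_reals all_analysis.
From mathcomp Require Import perm measurable_realfun ess_sup_inf.
From mathcomp Require Import ring lra.

Import Order.TTheory GRing.Theory Num.Theory.
Import numFieldNormedType.Exports.

Local Open Scope classical_set_scope.
Local Open Scope ring_scope.

Set Implicit Arguments.
Unset Strict Implicit.
Unset Printing Implicit Defensive.

(** * Functions of class C^1 on an interval *)

(** The order of the large derivative of Phi changes from point to point, while the number of pieces
    with a fixed order must not depend on omega. Measuring order k against lam^k makes van der
    Corput's estimate give 1 / lam for every order, so pieces of different orders combine without
    loss. Oscillatory integrals are increments of a primitive, which add up under subdivision;
    bounds on integrals become comparisons of derivatives.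

    The slabs are not orthogonal, so their intersection is measured by translation: vectors dual to
    gamma', ..., gamma^(m), bounded uniformly in t, move points across one slab without leaving the
    others. The level set itself is only covered, by a measurable union of slabs, and the L^q
    integral is dominated through a pointwise combination of indicators.

    In the summation the level is x = 1 / lam, running upward from R^(-1/2); what lies below
    contributes R^(-q/2), which is harmless as sigma <= 1/2. In general only sigma <= one chosen
    term of the minimum is used, so the minimum is never located. *)

Section C1_on.
Context {R : realType}.
Implicit Types (u v t c : R) (f g : R -> R).

(** The derivative is prescribed only in the open interval, which is all the mean value theorem asks
    for and suits derivatives that are one-sided at the end points. In a chain of derivatives,
    continuity of [f'] comes from the next pair. *)
Definition C1_on u v f f' :=
  {within `[u, v], continuous f} /\
  forall t, u < t < v -> is_derive t (1 : R) f (f' t).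

Lemma C1_on_sub u v u' v' f f' : u <= u' -> v' <= v ->
  C1_on u v f f' -> C1_on u' v' f f'.
Proof.
move=> uu vv [cf df]; split.
  by apply: continuous_subspaceW cf; apply: subset_itv; rewrite bnd_simp.
move=> t /andP[ut tv]; apply: df.
by rewrite (le_lt_trans uu)//= (lt_le_trans tv).
Qed.

Lemma C1_on_ext u v f f' g' : (forall t, u < t < v -> f' t = g' t) ->
  C1_on u v f f' -> C1_on u v f g'.
Proof.
by move=> fg [cf df]; split=> // t ut; rewrite -fg//; exact: df.
Qed.

Lemma C1_onN u v f f' : C1_on u v f f' -> C1_on u v (\- f) (\- f').
Proof.
move=> [cf df]; split; first by move=> t; apply: continuousN; exact: cf.
by move=> t ut; have ? := df t ut; exact: is_deriveN.
Qed.

Lemma C1_onD u v f f' g g' : C1_on u v f f' -> C1_on u v g g' ->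
  C1_on u v (f \+ g) (f' \+ g').
Proof.
move=> [cf df] [cg dg]; split.
  by move=> t; apply: continuousD; [exact: cf|exact: cg].
by move=> t ut; have ? := df t ut; have ? := dg t ut; exact: is_deriveD.
Qed.

Lemma C1_onB u v f f' g g' : C1_on u v f f' -> C1_on u v g g' ->
  C1_on u v (f \- g) (f' \- g').
Proof. by move=> Cf Cg; apply: C1_onD => //; exact: C1_onN. Qed.

Lemma C1_onM u v f f' g g' : C1_on u v f f' -> C1_on u v g g' ->
  C1_on u v (f \* g) (fun t => f t * g' t + g t * f' t).
Proof.
move=> [cf df] [cg dg]; split.
  by move=> t; apply: continuousM; [exact: cf|exact: cg].
by move=> t ut; have ? := df t ut; have ? := dg t ut; exact: is_deriveM.
Qed.

Lemma C1_onV u v f f' : (forall t, u <= t <= v -> f t != 0) ->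
  C1_on u v f f' -> C1_on u v (fun t => (f t)^-1) (fun t => - f' t / f t ^+ 2).
Proof.
move=> f0 [cf df]; split.
  rewrite continuous_subspace_in => t tI.
  apply: continuousV; first by apply: f0; move: tI; rewrite inE/= in_itv.
  exact: cf.
move=> t /[dup] /andP[ut tv] /df ?; have ft0 : f t != 0 by rewrite f0// !ltW.
have dV : derivable (fun y => (f y)^-1) t 1 by apply: derivableV => //; exact: ex_derive.
apply: DeriveDef => //; rewrite deriveV// derive_val.
by rewrite /GRing.scale/= mulNr mulNr mulrC.
Qed.

Lemma C1_on_cst u v c : C1_on u v (cst c) (cst 0).
Proof. by split=> [|t _]; [exact/continuous_subspaceT/cst_continuous|exact: is_derive_cst]. Qed.

Lemma C1_on_id u v : C1_on u v id (cst 1).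
Proof. by split=> [|t _]; [by apply: continuous_subspaceT => x; exact: cvg_id|exact: is_derive_id]. Qed.

Lemma C1_on_comp u v f f' h h' : (forall x : R, is_derive x (1 : R) h (h' x)) ->
  C1_on u v f f' -> C1_on u v (h \o f) (fun t => f' t * h' (f t)).
Proof.
move=> dh [cf df]; split.
  apply/subspace_continuousP => t tI; apply: continuous_cvg.
    have /derivable1_diffP : derivable h (f t) 1 by have ? := dh (f t).
    exact: differentiable_continuous.
  by move/subspace_continuousP : cf; exact.
move=> t ut; have ? := df t ut; have ? := dh (f t).
by rewrite mulrC; exact: is_derive1_comp.
Qed.

Lemma C1_on_le u v f f' : u <= v -> C1_on u v f f' ->
  (forall t, u < t < v -> 0 <= f' t) -> f u <= f v.
Proof.
rewrite le_eqVlt => /predU1P[->//|uv] [cf df] f0.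
have df' t : t \in `]u, v[ -> is_derive t (1 : R) f (f' t).
  by rewrite in_itv/=; exact: df.
have [t + E] := MVT uv df' cf.
by rewrite in_itv/= => ut; rewrite -subr_ge0 E mulr_ge0 ?f0// subr_ge0 ltW.
Qed.

Lemma C1_on_lip u v f f' c : u <= v -> C1_on u v f f' ->
  (forall t, u < t < v -> `|f' t| <= c) -> `|f v - f u| <= c * (v - u).
Proof.
rewrite le_eqVlt => /predU1P[->|uv] [cf df] fc.
  by rewrite !subrr normr0 mulr0.
have df' t : t \in `]u, v[ -> is_derive t (1 : R) f (f' t).
  by rewrite in_itv/=; exact: df.
have [t + ->] := MVT uv df' cf.
rewrite in_itv/= => ut; rewrite normrM (gtr0_norm (x:=v-u)) ?subr_gt0//.
by rewrite ler_pM2r ?subr_gt0// fc.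
Qed.

(** Both [h - f] and [h + f] are nondecreasing. This replaces bounding an integral of [|f'|]. *)
Lemma C1_on_le_incr u v f f' h h' : u <= v ->
  C1_on u v f f' -> C1_on u v h h' ->
  (forall t, u < t < v -> `|f' t| <= h' t) -> `|f v - f u| <= h v - h u.
Proof.
move=> uv Cf Ch fh.
have := C1_on_le uv (C1_onB Ch Cf) => /= P1.
have := C1_on_le uv (C1_onD Ch Cf) => /= P2.
have {}P1 : h u - f u <= h v - f v.
  by apply: P1 => t /fh; rewrite ler_norml => /andP[]; lra.
have {}P2 : h u + f u <= h v + f v.
  by apply: P2 => t /fh; rewrite ler_norml => /andP[]; lra.
by rewrite ler_norml; apply/andP; split; lra.
Qed.

(** By monotonicity [f] passes the level [c] once. The alternatives [w = u] and [w = v] stand for a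
    piece that shrinks to a point, on which nothing is claimed about [f]. *)
Lemma C1_on_split u v f f' c : u <= v -> C1_on u v f f' ->
  (forall t, u <= t <= v -> 0 <= f' t) ->
  exists w, [/\ u <= w <= v, w = u \/ (forall t, u <= t <= w -> f t <= c) &
    w = v \/ (forall t, w <= t <= v -> c <= f t)].
Proof.
move=> uv Cf f0.
have mf s t : u <= s -> s <= t -> t <= v -> f s <= f t.
  move=> us st tv; apply: (@C1_on_le _ _ f f') => //; first exact: C1_on_sub Cf.
  by move=> x /andP[sx xt]; rewrite f0// (le_trans us (ltW sx)) (le_trans (ltW xt)).
have [cu|uc] := leP c (f u).
  exists u; rewrite lexx uv; split=> //; first by left.
  by right=> t /andP[ut tv]; rewrite (le_trans cu)// mf.
have [vc|cv] := leP (f v) c.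
  exists v; rewrite lexx uv; split=> //; last by left.
  by right=> t /andP[ut tv]; rewrite (le_trans _ vc)// mf.
have [|w] := IVT uv Cf.1 (v := c).
  by rewrite ge_min le_max (ltW uc) (ltW cv) orbT.
rewrite in_itv/= => /andP[uw wv] fw; exists w; rewrite uw wv; split=> //; right=> t.
- by move=> /andP[ut tw]; rewrite -fw mf.
- by move=> /andP[wt tv]; rewrite -fw mf.
Qed.
End C1_on.

(** * Oscillatory integrals *)

Section van_der_corput.
Context {R : realType}.
Implicit Types (u v t c B lam : R) (g : nat -> R -> R) (psi P W : R -> R).

(* [g n] stands for the [n]-th derivative of the phase, [P] for a primitive of
   the oscillating integrand [cos (g 0) * psi]. *)
Definition oscillatory u v g psi dpsi P B :=
  [/\ u <= v, forall n, C1_on u v (g n) (g n.+1), C1_on u v psi dpsi,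
    C1_on u v P (fun t => cos (g 0 t) * psi t) &
    forall t, u <= t <= v -> `|psi t| <= B /\ `|dpsi t| <= B].

Lemma oscillatory_sub u v u' v' g psi dpsi P B :
  u <= u' -> u' <= v' -> v' <= v ->
  oscillatory u v g psi dpsi P B -> oscillatory u' v' g psi dpsi P B.
Proof.
move=> uu uv vv [_ Cg Cpsi CP psiB]; split => //.
- by move=> n; exact: C1_on_sub (Cg n).
- exact: C1_on_sub Cpsi.
- exact: C1_on_sub CP.
- by move=> t /andP[ut tv]; apply: psiB; rewrite (le_trans uu)//= (le_trans tv).
Qed.

Lemma oscillatoryN u v g psi dpsi P B :
  oscillatory u v g psi dpsi P B ->
  oscillatory u v (fun n => \- g n) psi dpsi P B.
Proof.
move=> [uv Cg Cpsi CP psiB]; split => //; first by move=> n; exact: C1_onN.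
by under [X in C1_on _ _ _ X]funext do rewrite cosN.
Qed.

Lemma oscillatory_lip u v g psi dpsi P B :
  oscillatory u v g psi dpsi P B -> `|P v - P u| <= B * (v - u).
Proof.
move=> [uv Cg Cpsi CP psiB]; apply: C1_on_lip CP _ => // t /andP[ut tv].
have /psiB[psit _] : u <= t <= v by rewrite !ltW.
by rewrite normrM -[B]mul1r ler_pM// ler_norml cos_geN1 cos_le1.
Qed.

Lemma oscillatory_ge0 u v g psi dpsi P B :
  oscillatory u v g psi dpsi P B -> 0 <= B.
Proof.
move=> [uv _ _ _ psiB]; have [|psiu _] := psiB u; first by rewrite lexx.
exact: le_trans psiu.
Qed.

(** Integration by parts: subtracting [h = psi * sin (g 0) / g 1] from [P] leaves a derivative made
    of a term in [g 2 / g 1 ^ 2] and a term in [dpsi / g 1]. The second is at most [B / lam], and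
    [h] at the two ends gives the 2. The first is left to a majorant [W], since two are used:
    [- B / g 1] when [g 2] has a sign, a linear function when [g 2] is only bounded. *)
Lemma nonstationary_incr u v g psi dpsi P B lam W dW :
  oscillatory u v g psi dpsi P B -> 0 < lam ->
  (forall t, u <= t <= v -> lam <= `|g 1%N t|) ->
  C1_on u v W dW ->
  (forall t, u < t < v -> B * `|g 2%N t| / g 1%N t ^+ 2 <= dW t) ->
  `|P v - P u| <= (2 + (v - u)) * B / lam + (W v - W u).
Proof.
move=> H lam0 g1lam CW gW; have B0 := oscillatory_ge0 H.
have [uv Cg Cpsi CP psiB] := H.
have g10 t : u <= t <= v -> g 1%N t != 0.
  by move=> /g1lam gt; rewrite -normr_gt0 (lt_le_trans lam0).
have Csin := C1_on_comp (@is_derive_sin R) (Cg 0%N).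
pose h := (psi \* (sin \o g 0%N)) \* (fun t => (g 1%N t)^-1).
have Ch := C1_onM (C1_onM Cpsi Csin) (C1_onV g10 (Cg 1%N)); rewrite -/h in Ch.
have hB t : u <= t <= v -> `|h t| <= B / lam.
  move=> ut; have [psit _] := psiB t ut.
  rewrite /h/= !normrM normfV ler_pM//.
    by rewrite -[B]mulr1 ler_pM// ler_norml sin_geN1 sin_le1.
  by rewrite lef_pV2 ?posrE ?g1lam// normr_gt0 g10.
have CD := C1_onB CP Ch.
have CL := C1_onD (C1_onM (C1_on_cst u v (B / lam)) (C1_on_id u v)) CW.
have := C1_on_le_incr uv CD CL => /(_ _)/wrap[|].
  move=> t /[dup] utv /andP[/ltW ut /ltW tv].
  have utv' : u <= t <= v by rewrite ut.
  have [psit dpsit] := psiB t utv'.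
  rewrite /= mulr0 mulr1 addr0.
  rewrite [X in `|X|](_ : _ = psi t * sin (g 0%N t) * (g 2%N t / g 1%N t ^+ 2)
      - sin (g 0%N t) * dpsi t / g 1%N t); last by move: (g10 t utv'); clear; move=> g10; field.
  have sinB : `|sin (g 0%N t)| <= 1 by rewrite ler_norml sin_geN1 sin_le1.
  rewrite (le_trans (ler_normB _ _))// addrC lerD//.
    rewrite !normrM normfV -[B in leRHS]mul1r ler_pM ?mulr_ge0//.
      by rewrite ler_pM.
    by rewrite lef_pV2 ?posrE ?g1lam// normr_gt0 g10.
  rewrite (le_trans _ (gW t utv))// !normrM normfV normrX real_normK ?num_real//.
  rewrite -[leRHS]mulrA; apply: ler_wpM2r.
    by rewrite divr_ge0// sqr_ge0.
  by rewrite -[B]mulr1 ler_pM.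
rewrite /= => L.
have := hB v; rewrite lexx uv => /(_ isT); rewrite ler_norml => /andP[hv1 hv2].
have := hB u; rewrite lexx uv => /(_ isT); rewrite ler_norml => /andP[hu1 hu2].
have -> : (2 + (v - u)) * B / lam = 2 * (B / lam) + (B / lam * v - B / lam * u).
  by ring.
move: L; rewrite !ler_norml => /andP[L1 L2]; clear -L1 L2 hv1 hv2 hu1 hu2.
by apply/andP; split; lra.
Qed.

Definition same_sign u v (f : R -> R) :=
  (forall t, u <= t <= v -> 0 <= f t) \/ (forall t, u <= t <= v -> f t <= 0).

(** The cut at 0, besides those at [- c] and [c], gives [f] a constant sign on each inner piece,
    which an induction on the order of the derivative requires. *)
Lemma monotone_pieces u v f df c : 0 <= c -> u <= v -> C1_on u v f df ->
  (forall t, u <= t <= v -> 0 <= df t) ->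
  exists w1 w0 w2, [/\ [/\ u <= w1, w1 <= w0, w0 <= w2 & w2 <= v],
    w1 = u \/ (forall t, u <= t <= w1 -> f t <= - c),
    w0 = w1 \/ (forall t, w1 <= t <= w0 -> - c <= f t <= 0),
    w2 = w0 \/ (forall t, w0 <= t <= w2 -> 0 <= f t <= c) &
    v = w2 \/ (forall t, w2 <= t <= v -> c <= f t)].
Proof.
move=> c0 uv Cf f0.
have sp w e : u <= w -> w <= v -> exists w', [/\ w <= w' <= v,
    w' = w \/ (forall t, w <= t <= w' -> f t <= e) &
    w' = v \/ (forall t, w' <= t <= v -> e <= f t)].
  move=> uw wv; apply: (C1_on_split _ wv (C1_on_sub uw (lexx v) Cf)).
  by move=> t /andP[wt tv]; rewrite f0// tv (le_trans uw).
have [w1 [/andP[uw1 w1v] L1 R1]] := sp u (- c) (lexx u) uv.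
have [w0 [/andP[w10 w0v] L0 R0]] := sp w1 0 uw1 w1v.
have [w2 [/andP[w02 w2v] L2 R2]] := sp w0 c (le_trans uw1 w10) w0v.
exists w1, w0, w2; split => //.
- case: L0 => [|L0]; [by left|].
  case: R1 => [E|R1]; first by left; apply/eqP; rewrite eq_le w10 E w0v.
  right=> t /[dup] /L0 -> /andP[wt tw].
  by rewrite R1// wt (le_trans tw).
- case: L2 => [|L2]; [by left|].
  case: R0 => [E|R0]; first by left; apply/eqP; rewrite eq_le w02 E w2v.
  right=> t /[dup] /L2 -> /andP[wt tw].
  by rewrite R0// wt (le_trans tw).
- by case: R2 => [->|]; [left|right].
Qed.

(** When [g 2] has a sign, [g 1] is monotone and the variation of [1 / g 1] telescopes. The end
    values of [W = - B / g 1] raise the constant from 2 to 4. *)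
Lemma first_derivative_test l u v g psi dpsi P B lam :
  oscillatory u v g psi dpsi P B -> v - u <= l -> 0 < lam ->
  same_sign u v (g 2%N) -> (forall t, u <= t <= v -> lam <= `|g 1%N t|) ->
  `|P v - P u| <= (4 + l) * (B / lam).
Proof.
move=> + uvl lam0; wlog: g / forall t, u <= t <= v -> 0 <= g 2%N t.
  move=> W H [g2|g2]; first by apply: W => //; left.
  move=> g1; apply: (W _ _ (oscillatoryN H)).
  - by move=> t /g2 /=; rewrite oppr_ge0.
  - by left=> t /g2 /=; rewrite oppr_ge0.
  - by move=> t /g1 /=; rewrite normrN.
move=> g2 H _ g1; have B0 := oscillatory_ge0 H; have [uv Cg _ _ _] := H.
have g10 t : u <= t <= v -> g 1%N t != 0.
  by move=> /g1 gt; rewrite -normr_gt0 (lt_le_trans lam0).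
have CW := C1_onM (C1_on_cst u v (- B)) (C1_onV g10 (Cg 1%N)).
have := nonstationary_incr H lam0 g1 CW => /(_ _)/wrap[|].
  move=> t /andP[/ltW ut /ltW tv]; rewrite /= mulr0 addr0.
  by rewrite ger0_norm ?g2 ?ut// !mulNr mulrN opprK mulrA.
have WB t : u <= t <= v -> `|- B * (g 1%N t)^-1| <= B / lam.
  move=> ut; rewrite normrM normrN normfV (ger0_norm B0) ler_wpM2l//.
  by rewrite lef_pV2 ?posrE ?g1// normr_gt0 g10.
move=> /le_trans; apply.
have := WB v; rewrite lexx uv => /(_ isT); rewrite ler_norml => /andP[_ hv].
have := WB u; rewrite lexx uv => /(_ isT); rewrite ler_norml => /andP[hu _].
have : (v - u) * (B / lam) <= l * (B / lam).
  by apply: ler_wpM2r => //; rewrite divr_ge0// ltW.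
rewrite /= -mulrA !mulrDl; move: hu hv; clear; lra.
Qed.

(** Induction on the order. As [g k.+2 >= lam ^ k.+2], the function [g k.+1] is monotone; the lower
    order applies where it is at least [lam ^ k.+1] in absolute value. Each of the two remaining
    pieces has length at most [1 / lam] and is estimated trivially. Only order one needs the sign of
    [g 2], which the induction step supplies from [g k.+2] at [k = 0]. *)
Lemma van_der_corput l k : exists2 C, 0 <= C &
  forall u v g psi dpsi P B lam, oscillatory u v g psi dpsi P B ->
  v - u <= l -> 0 < lam -> (k = 0 -> same_sign u v (g 2%N)) ->
  (forall t, u <= t <= v -> lam ^+ k.+1 <= g k.+1 t) \/
  (forall t, u <= t <= v -> g k.+1 t <= - lam ^+ k.+1) ->
  `|P v - P u| <= C * (B / lam).
Proof.
elim: k => [|k [C C0 IH]].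
  exists `|4 + l|; first exact: normr_ge0.
  move=> u v g psi dpsi P B lam H uvl lam0 /(_ erefl) sg gl.
  have B0 := oscillatory_ge0 H.
  apply: le_trans (first_derivative_test H uvl lam0 sg _) _.
    move=> t ut; case: gl => /(_ t ut); rewrite expr1 ler_normr => gt.
      by rewrite gt.
    by rewrite orbC lerNr gt.
  by rewrite ler_wpM2r ?ler_norm// divr_ge0// ltW.
exists (2 * C + 2); first by rewrite addr_ge0// mulr_ge0.
move=> u v g psi dpsi P B lam H uvl lam0 _ gl.
wlog gl' : g H gl / forall t, u <= t <= v -> lam ^+ k.+2 <= g k.+2 t.
  move=> W; case: gl => gl; first by apply: (W g) => //; left.
  apply: (W (fun n => \- g n)); first exact: oscillatoryN.
    by left=> t /gl /=; rewrite lerNr.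
  by move=> t /gl /=; rewrite lerNr.
move: gl' => {}gl; have B0 := oscillatory_ge0 H; have [uv Cg _ _ _] := H.
have BL0 : 0 <= B / lam by rewrite divr_ge0// ltW.
have g0 t : u <= t <= v -> 0 <= g k.+2 t.
  by move=> /gl; apply: le_trans; rewrite exprn_ge0// ltW.
have lamk : 0 <= lam ^+ k.+1 by rewrite exprn_ge0// ltW.
have [w1 [w0 [w2 [[uw1 w10 w02 w2v] P1 P2 P3 P4]]]] :=
  monotone_pieces lamk uv (Cg k.+1) g0.
have outer w w' : u <= w -> w <= w' -> w' <= v ->
    (forall t, w <= t <= w' -> lam ^+ k.+1 <= g k.+1 t) \/
    (forall t, w <= t <= w' -> g k.+1 t <= - lam ^+ k.+1) ->
    `|P w' - P w| <= C * (B / lam).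
  move=> uw ww wv gw; apply: (IH w w' g psi dpsi) => //.
  - exact: oscillatory_sub H.
  - by rewrite (le_trans _ uvl)// lerB.
  - by move=> k0; left=> t /andP[wt tw]; have := g0 t; rewrite k0; apply; rewrite (le_trans uw)//= (le_trans tw).
have inner w w' : u <= w -> w <= w' -> w' <= v ->
    (w' = w \/ g k.+1 w' - g k.+1 w <= lam ^+ k.+1) -> `|P w' - P w| <= B / lam.
  move=> uw ww wv [->|gw]; first by rewrite subrr normr0.
  have H' := oscillatory_sub uw ww wv H; apply: le_trans (oscillatory_lip H') _.
  rewrite ler_wpM2l//.
  have [_ Cg' _ _ _] := H'.
  have CL := C1_onM (C1_on_cst w w' (lam ^+ k.+2)) (C1_on_id w w').
  have := C1_on_le_incr ww CL (Cg' k.+1) => /(_ _)/wrap[|].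
    move=> t /andP[/ltW wt /ltW tw].
    rewrite /= mulr1 mulr0 addr0 ger0_norm; last by rewrite exprn_ge0// ltW.
    by rewrite gl// (le_trans uw)//= (le_trans tw).
  rewrite /= -mulrBr => /(le_trans (ler_norm _))/le_trans/(_ gw).
  rewrite exprSr -mulrA -ler_pdivlMl ?exprn_gt0// mulVf ?gt_eqF ?exprn_gt0//.
  by rewrite -ler_pdivlMl// mulr1.
have Q1 : `|P w1 - P u| <= C * (B / lam).
  case: P1 => [->|P1]; first by rewrite subrr normr0 mulr_ge0.
  apply: outer => //; last by right.
  by rewrite (le_trans w10)// (le_trans w02).
have Q2 : `|P w0 - P w1| <= B / lam.
  apply: inner => //; first exact: le_trans w2v.
  case: P2 => [|P2]; [by left|right].
  have /andP[_] := P2 _ (introT andP (conj w10 (lexx w0))).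
  have /andP[+ _] := P2 _ (introT andP (conj (lexx w1) w10)).
  by clear; lra.
have Q3 : `|P w2 - P w0| <= B / lam.
  apply: inner => //; first exact: le_trans w10.
  case: P3 => [|P3]; [by left|right].
  have /andP[_] := P3 _ (introT andP (conj w02 (lexx w2))).
  have /andP[+ _] := P3 _ (introT andP (conj (lexx w0) w02)).
  by clear; lra.
have Q4 : `|P v - P w2| <= C * (B / lam).
  case: P4 => [->|P4]; first by rewrite subrr normr0 mulr_ge0.
  apply: outer => //; last by left.
  by rewrite (le_trans uw1)// (le_trans w10).
have -> : P v - P u = (P w1 - P u) + (P w0 - P w1) + (P w2 - P w0) + (P v - P w2).
  by clear; ring.
rewrite (le_trans (ler_normD _ _))// (le_trans (lerD (le_trans (ler_normD _ _)
  (lerD (le_trans (ler_normD _ _) (lerD Q1 Q2)) Q3)) Q4))//.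
by rewrite mulrDl -mulrA; move: (C * (B / lam)) (B / lam) => x y; clear; lra.
Qed.

(** The order of the large derivative may depend on the point. Since [g n.+3] has a sign, [g n.+2]
    is monotone: where it is large, van der Corput applies; where it is small, the large derivative
    has lower order and [g n.+2] has a sign on each of two pieces, so induction applies. The number
    of pieces depends on [n] alone. *)
Lemma oscillatory_bound l n : exists2 C, 0 <= C &
  forall u v g psi dpsi P B lam, oscillatory u v g psi dpsi P B ->
  v - u <= l -> 0 < lam -> same_sign u v (g n.+2) ->
  (forall t, u <= t <= v -> exists2 k, (1 <= k <= n.+1)%N & lam ^+ k < `|g k t|) ->
  `|P v - P u| <= C * (B / lam).
Proof.
elim: n => [|n [C C0 IH]].
  exists `|4 + l|; first exact: normr_ge0.
  move=> u v g psi dpsi P B lam H uvl lam0 sg gl.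
  have B0 := oscillatory_ge0 H.
  apply: le_trans (first_derivative_test H uvl lam0 sg _) _.
    by move=> t /gl[[|[|//]]// _]; rewrite expr1; exact: ltW.
  by rewrite ler_wpM2r ?ler_norm// divr_ge0// ltW.
have [D D0 VC] := van_der_corput l n.+1.
exists (2 * C + 2 * D); first by rewrite addr_ge0// mulr_ge0.
move=> u v g psi dpsi P B lam H uvl lam0 gs gl.
wlog gs' : g H gl gs / forall t, u <= t <= v -> 0 <= g n.+3 t.
  move=> W; case: gs => gs; first by apply: (W g) => //; left.
  apply: (W (fun n => \- g n)); first exact: oscillatoryN.
  - by move=> t /gl[k kn]; exists k => //=; rewrite normrN.
  - by left=> t /gs /=; rewrite oppr_ge0.
  - by move=> t /gs /=; rewrite oppr_ge0.
move: gs' => {}gs; have B0 := oscillatory_ge0 H; have [uv Cg _ _ _] := H.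
have BL0 : 0 <= B / lam by rewrite divr_ge0// ltW.
have lamk : 0 <= lam ^+ n.+2 by rewrite exprn_ge0// ltW.
have [w1 [w0 [w2 [[uw1 w10 w02 w2v] P1 P2 P3 P4]]]] :=
  monotone_pieces lamk uv (Cg n.+2) gs.
have uw0 := le_trans uw1 w10; have uw2 := le_trans uw0 w02.
have w0v := le_trans w02 w2v; have w1v := le_trans w10 w0v.
have outer w w' : u <= w -> w <= w' -> w' <= v ->
    (forall t, w <= t <= w' -> lam ^+ n.+2 <= g n.+2 t) \/
    (forall t, w <= t <= w' -> g n.+2 t <= - lam ^+ n.+2) ->
    `|P w' - P w| <= D * (B / lam).
  move=> uw ww wv gw; apply: (VC w w' g psi dpsi) => //.
  - exact: oscillatory_sub H.
  - by rewrite (le_trans _ uvl)// lerB.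
have inner w w' : u <= w -> w <= w' -> w' <= v -> same_sign w w' (g n.+2) ->
    (forall t, w <= t <= w' -> `|g n.+2 t| <= lam ^+ n.+2) ->
    `|P w' - P w| <= C * (B / lam).
  move=> uw ww wv sw gw; apply: (IH w w' g psi dpsi) => //.
  - exact: oscillatory_sub H.
  - by rewrite (le_trans _ uvl)// lerB.
  - move=> t /[dup] wt /andP[wt1 wt2].
    have [|k /andP[k1 kn] gk] := gl t; first by rewrite (le_trans uw)//= (le_trans wt2).
    have kn' : k != n.+2 by apply: contraTneq gk => ->; rewrite -leNgt gw.
    by exists k => //; rewrite k1/= -ltnS ltn_neqAle kn' kn.
have Q1 : `|P w1 - P u| <= D * (B / lam).
  case: P1 => [->|P1]; first by rewrite subrr normr0 mulr_ge0.
  by apply: outer => //; right.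
have Q2 : `|P w0 - P w1| <= C * (B / lam).
  case: P2 => [->|P2]; first by rewrite subrr normr0 mulr_ge0.
  apply: inner => //; first by right=> t /P2/andP[].
  by move=> t /P2/andP[gt1 gt2]; rewrite ler0_norm// lerNl.
have Q3 : `|P w2 - P w0| <= C * (B / lam).
  case: P3 => [->|P3]; first by rewrite subrr normr0 mulr_ge0.
  apply: inner => //; first by left=> t /P3/andP[].
  by move=> t /P3/andP[gt1 gt2]; rewrite ger0_norm.
have Q4 : `|P v - P w2| <= D * (B / lam).
  case: P4 => [->|P4]; first by rewrite subrr normr0 mulr_ge0.
  by apply: outer => //; left.
have -> : P v - P u = (P w1 - P u) + (P w0 - P w1) + (P w2 - P w0) + (P v - P w2).
  by clear; ring.
rewrite (le_trans (ler_normD _ _))// (le_trans (lerD (le_trans (ler_normD _ _)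
  (lerD (le_trans (ler_normD _ _) (lerD Q1 Q2)) Q3)) Q4))//.
by rewrite mulrDl; rewrite -!mulrA; move: (C * (B / lam)) (D * (B / lam)) => x y; clear; lra.
Qed.

End van_der_corput.

(** * Oscillatory integrals with phases of finite type *)

Section finite_type_phase.
Context {R : realType}.
Implicit Types (a b u v s t c B r lam : R) (g : nat -> R -> R) (psi P : R -> R).

(** [N] is fixed before [P] and [D], so that the number of pieces does not depend on the
    direction. *)
Lemma subdivision_bound a b dlt : a <= b -> 0 < dlt -> exists N : nat,
  forall P D, (forall u v, a <= u -> u <= v -> v <= b -> v - u <= dlt ->
    `|P v - P u| <= D) -> `|P b - P a| <= N%:R * D.
Proof.
move=> ab dlt0; pose N := (Num.truncn ((b - a) / dlt)).+1.
have N0 : 0 < N%:R :> R by rewrite ltr0n.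
have Nd : (b - a) / N%:R <= dlt.
  rewrite ler_pdivrMr// mulrC -ler_pdivrMr//.
  by rewrite ltW// truncnS_gt.
have h0 : 0 <= (b - a) / N%:R by rewrite divr_ge0// subr_ge0.
exists N => P D PD.
pose w (i : nat) := a + i%:R * ((b - a) / N%:R).
have wN : w N = b by rewrite /w mulrC divfK ?gt_eqF// addrC subrK.
have w0 : w 0%N = a by rewrite /w mul0r addr0.
have -> : P b - P a = \sum_(0 <= i < N) (P (w i.+1) - P (w i)).
  by rewrite (telescope_sumr (fun i => P (w i)))// wN w0.
apply: le_trans (ler_norm_sum _ _ _) _.
have -> : N%:R * D = \sum_(i < N) D by rewrite sumr_const card_ord mulr_natl.
rewrite big_mkord; apply: ler_sum => -[i /= iN] _.
have wS : w i.+1 - w i = (b - a) / N%:R by rewrite /w -natr1; clear; ring.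
apply: PD; last by rewrite wS.
- by rewrite /w lerDl mulr_ge0.
- by rewrite -subr_ge0 wS.
- by rewrite -wN /w lerD2l ler_wpM2r// ler_nat.
Qed.

(** On a subinterval of length at most [dlt] one derivative of fixed order keeps its sign and has
    size at least [c * r]. At order one the phase is nonstationary. At a higher order [n], van der
    Corput suffices if [lam ^ n <= M * r]; otherwise the derivatives from order [n] on are too small
    to be the large one. *)
Lemma finite_type_bound a b c M dlt L : a <= b -> 0 < c -> 0 < M -> 0 < dlt ->
  exists2 C, 0 <= C & forall g psi dpsi P B r lam,
  oscillatory a b g psi dpsi P B -> 0 < r -> 1 <= lam ->
  (forall t k, (k <= L)%N -> a <= t <= b -> `|g k.+1 t| <= M * r) ->
  (forall s, a <= s <= b -> exists2 n, (1 <= n <= L)%N &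
    (forall t, a <= t <= b -> `|t - s| <= dlt -> c * r <= g n t) \/
    (forall t, a <= t <= b -> `|t - s| <= dlt -> g n t <= - (c * r))) ->
  (forall s, a <= s <= b -> exists2 k, (1 <= k <= L)%N & lam ^+ k < `|g k s|) ->
  `|P b - P a| <= C * (B / lam).
Proof.
move=> ab c0 M0 dlt0.
have [N subN] := subdivision_bound ab dlt0.
have /choice[VC VCP] := fun k => let: ex_intro2 C C0 CP := van_der_corput dlt k in
  ex_intro (fun C => 0 <= C /\ _) C (conj C0 CP).
have /choice[OB OBP] := fun k => let: ex_intro2 C C0 CP := oscillatory_bound dlt k in
  ex_intro (fun C => 0 <= C /\ _) C (conj C0 CP).
have le_sumL (F : nat -> R) k : (forall k, 0 <= F k) -> (k < L)%N ->
    F k <= \sum_(i < L) F i.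
  move=> F0 kL; rewrite (bigD1 (Ordinal kL))//= lerDl.
  by apply: sumr_ge0 => i _; exact: F0.
(* For [n >= 1], [kap ^ n <= kap <= c / M] turns [lam ^ n <= M * r] into
   [(kap * lam) ^ n <= c * r]. *)
pose kap := Num.min 1 (c / M).
have kap0 : 0 < kap by rewrite /kap lt_min ltr01 divr_gt0.
pose X := ((2 + dlt) / c + M * dlt / c ^+ 2) * M.
have X0 : 0 <= X.
  by rewrite mulr_ge0 ?(ltW M0)// addr_ge0// divr_ge0 ?sqr_ge0 ?(ltW c0)//
    ?mulr_ge0 ?addr_ge0 ?(ltW M0) ?(ltW dlt0).
pose D := X + \sum_(i < L) (VC i / kap) + \sum_(i < L) OB i.
have VC0 k : 0 <= VC k / kap by rewrite divr_ge0 ?(ltW kap0)//; have [] := VCP k.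
have OB0 k : 0 <= OB k by have [] := OBP k.
have VS0 : 0 <= \sum_(i < L) (VC i / kap) by apply: sumr_ge0.
have OS0 : 0 <= \sum_(i < L) OB i by apply: sumr_ge0.
exists (N%:R * D); first by rewrite mulr_ge0// !addr_ge0.
move=> g psi dpsi P B r lam H r0 lam1 gM gc glam.
have B0 := oscillatory_ge0 H; have lam0 : 0 < lam := lt_le_trans ltr01 lam1.
have BL0 : 0 <= B / lam by rewrite divr_ge0// ltW.
rewrite -mulrA; apply: subN => u v au uv vb uvd.
have Iuv t : u <= t <= v -> (a <= t <= b) /\ `|t - u| <= dlt.
  move=> /andP[ut tv]; rewrite (le_trans au)//= (le_trans tv)//; split => //.
  by rewrite ger0_norm ?subr_ge0// (le_trans _ uvd)// lerB.
have H' := oscillatory_sub au uv vb H.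
have uu : u <= u <= v by rewrite lexx.
have [Iu _] := Iuv _ uu.
have [n /andP[n1 nL] gn] := gc u Iu.
have {}gn : (forall t, u <= t <= v -> c * r <= g n t) \/
    (forall t, u <= t <= v -> g n t <= - (c * r)).
  case: gn => gn; [left|right] => t /Iuv[ut td]; exact: gn.
have cr0 : 0 < c * r by rewrite mulr_gt0.
(* As [lam >= 1], whichever derivative is large at [u] exceeds [lam]. Hence [1 / r <= M / lam],
   which converts the gain [1 / r] at order one. *)
have MrL : lam <= M * r.
  have [[//|k] /andP[_ kL] gk] := glam u Iu.
  apply: le_trans (gM u k (ltnW kL) Iu); apply: le_trans (ltW gk).
  by rewrite exprS ler_peMr ?(ltW lam0)// exprn_ege1.
case: n => [//|[|n]] in n1 nL gn *.
  have g1 t : u <= t <= v -> c * r <= `|g 1%N t|.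
    by move=> ut; rewrite ler_normr; case: gn => /(_ t ut); [|rewrite lerNr] => ->;
      rewrite ?orbT.
  pose K := B * (M * r) / (c * r) ^+ 2.
  have CW := C1_onM (C1_on_cst u v K) (C1_on_id u v).
  have := nonstationary_incr H' cr0 g1 CW => /(_ _)/wrap[|].
    move=> t /andP[/ltW ut /ltW tv]; have /Iuv[It _] : u <= t <= v by rewrite ut.
    have gt : c * r <= `|g 1%N t| by apply: g1; rewrite ut.
    rewrite /= mulr0 mulr1 addr0 /K ler_pM ?mulr_ge0 ?invr_ge0 ?sqr_ge0//.
      by rewrite ler_wpM2l// gM.
    have cg2 : (c * r) ^+ 2 <= g 1%N t ^+ 2.
      rewrite -(real_normK (num_real (g 1%N t))) lerXn2r// nnegrE//.
      exact: ltW.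
    have cr2 : 0 < (c * r) ^+ 2 by rewrite exprn_gt0.
    by rewrite lef_pV2 ?posrE// (lt_le_trans cr2).
  move=> /le_trans; apply.
  have rL : r^-1 <= M / lam.
    by rewrite ler_pdivlMr// mulrC ler_pdivrMr.
  apply: (@le_trans _ _ (X * (B / lam))); last first.
    by rewrite ler_wpM2r// /D -addrA lerDl addr_ge0.
  rewrite /= -mulrBr.
  apply: (@le_trans _ _ ((2 + dlt) * B / (c * r) + K * dlt)).
    apply: lerD; last by rewrite ler_wpM2l// divr_ge0 ?sqr_ge0// !mulr_ge0// ltW.
    by rewrite ler_wpM2r ?invr_ge0 ?(ltW cr0)// ler_wpM2r// lerD2l.
  have -> : (2 + dlt) * B / (c * r) + K * dlt =
      ((2 + dlt) / c + M * dlt / c ^+ 2) * B * r^-1.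
    rewrite /K; move: (gt_eqF r0) (gt_eqF c0) => /negbT r0' /negbT c0'.
    by move: r0' c0'; clear => r0 c0; field; rewrite r0.
  rewrite /X -[leRHS]mulrA -[leLHS]mulrA ler_wpM2l//.
    by rewrite addr_ge0// divr_ge0 ?sqr_ge0 ?(ltW c0)//
      ?mulr_ge0 ?addr_ge0 ?(ltW M0) ?(ltW dlt0).
  by rewrite mulrCA ler_wpM2l.
have [lamM|Mlam] := leP (lam ^+ n.+2) (M * r).
  have [_ VCn] := VCP n.+1.
  have kl : (kap * lam) ^+ n.+2 <= c * r.
    rewrite exprMn; apply: (@le_trans _ _ (c / M * (M * r))); last first.
      by rewrite mulrA divfK// gt_eqF.
    rewrite ler_pM ?exprn_ge0 ?(ltW lam0) ?(ltW kap0)//.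
    rewrite exprS; apply: (@le_trans _ _ (kap * 1)).
      by rewrite ler_wpM2l ?(ltW kap0)// exprn_ile1 ?(ltW kap0)// /kap ge_min lexx.
    by rewrite mulr1 /kap ge_min lexx orbT.
  apply: le_trans (VCn u v g psi dpsi P B (kap * lam) H' uvd _ _ _) _ => //.
  - by rewrite mulr_gt0.
  - case: gn => gn; [left|right] => t /gn gt; first exact: le_trans gt.
    by apply: le_trans gt _; rewrite lerN2.
  - have -> : VC n.+1 * (B / (kap * lam)) = VC n.+1 / kap * (B / lam).
      clear -kap0 lam0; move: (VC n.+1) => x.
      by field; rewrite !gt_eqF.
    rewrite ler_wpM2r//.
    rewrite /D; apply: (@le_trans _ _ (\sum_(i < L) (VC i / kap))).
      exact: (le_sumL (fun k => VC k / kap)).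
    by move: X0 OS0; clear; lra.
(* Every derivative is at most [M * r < lam ^ n.+2], so the large one has order at most [n.+1],
   while [g n.+2] keeps its sign. *)
have [_ OBn] := OBP n.
apply: le_trans (OBn u v g psi dpsi P B lam H' uvd lam0 _ _) _.
- case: gn => gn; [left|right] => t /gn gt; first exact: le_trans (ltW cr0) gt.
  by apply: le_trans gt _; rewrite oppr_le0 ltW.
- move=> t /Iuv[It _]; have [k /andP[k1 kL] gk] := glam t It.
  exists k => //; rewrite k1/= leqNgt; apply/negP => nk; move: gk; apply/negP.
  rewrite -leNgt; case: k k1 kL nk => // k _ kL nk.
  apply: le_trans (gM t k (ltnW kL) It) _; apply: le_trans (ltW Mlam) _.
  by rewrite ler_weXn2l.
- rewrite ler_wpM2r// /D; apply: (@le_trans _ _ (\sum_(i < L) OB i)).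
    by apply: le_sumL => //; exact: ltnW.
  by move: X0 VS0; clear; lra.
Qed.

Lemma C1_on_lip_norm a b f df c s t : C1_on a b f df ->
  a <= s <= b -> a <= t <= b ->
  (forall x, a < x < b -> `|x - s| <= `|t - s| -> `|df x| <= c) ->
  `|f t - f s| <= c * `|t - s|.
Proof.
move=> Cf /andP[sa sb] /andP[ta tb] dfc.
have [st|ts] := leP s t.
  rewrite (ger0_norm (x:=t - s)) ?subr_ge0//.
  apply: (C1_on_lip st (C1_on_sub sa tb Cf)) => x /andP[sx xt].
  apply: dfc; first by rewrite (le_lt_trans sa)//= (lt_le_trans xt).
  by rewrite !ger0_norm ?subr_ge0// ?lerB// ltW.
rewrite distrC (distrC t).
rewrite (gtr0_norm (x:=s - t)) ?subr_gt0//.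
apply: (C1_on_lip (ltW ts) (C1_on_sub ta sb Cf)) => x /andP[tx xs].
apply: dfc; first by rewrite (le_lt_trans ta)//= (lt_le_trans xs).
by rewrite !(distrC _ s) !ger0_norm ?subr_ge0 ?lerB// ltW.
Qed.

(** Taylor's formula as a descending induction from order [L.+1], which is controlled on the whole
    interval. Moving from [s] by at most [1 / lam] costs one factor [lam] less than the order above,
    and the value at [s] adds 1 to the constant. *)
Lemma derivatives_near a b g E lam s t L : a <= s <= b -> a <= t <= b ->
  (forall n, C1_on a b (g n) (g n.+1)) ->
  0 < lam -> 0 <= E -> `|t - s| <= lam^-1 ->
  (forall k, (1 <= k <= L)%N -> `|g k s| <= lam ^+ k) ->
  (forall x, a <= x <= b -> `|g L.+1 x| <= E * lam ^+ L.+1) ->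
  forall k, (1 <= k <= L.+1)%N -> `|g k t| <= (E + L%:R) * lam ^+ k.
Proof.
move=> Is It Cg lam0 E0 ts gs gE.
suff W j x : (j <= L)%N -> a <= x <= b -> `|x - s| <= `|t - s| ->
    `|g (L.+1 - j)%N x| <= (E + j%:R) * lam ^+ (L.+1 - j).
  move=> k /andP[k1 kL].
  have jL : (L.+1 - k <= L)%N by rewrite leq_subLR -add1n leq_add2r.
  have := W _ t jL It (lexx _); rewrite subKn// => /le_trans; apply.
  by rewrite ler_wpM2r ?exprn_ge0 ?(ltW lam0)// lerD2l ler_nat.
elim: j x => [|j IH] x jL Ix xs; first by rewrite subn0 addr0 gE.
have k1 : (1 <= L.+1 - j.+1 <= L)%N by rewrite subSS subn_gt0 jL leq_subr.
have kE : (L.+1 - j = (L.+1 - j.+1).+1)%N by rewrite subSS subSn// ltnW.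
set k := (L.+1 - j.+1)%N in k1 kE *.
have := C1_on_lip_norm (Cg k) Is Ix => /(_ ((E + j%:R) * lam ^+ k.+1))/(_ _)/wrap[|].
  move=> y /andP[/ltW ay /ltW yb] ys; have := IH y (ltnW jL).
  rewrite ay yb kE; apply => //.
  exact: le_trans xs.
move=> Lip; rewrite -[g k x](subrK (g k s)) (le_trans (ler_normD _ _))//.
rewrite -natr1 addrA mulrDl mul1r lerD ?gs//.
apply: le_trans Lip _; rewrite -mulrA ler_wpM2l ?addr_ge0//.
rewrite exprSr -mulrA ler_piMr ?exprn_ge0 ?(ltW lam0)//.
by rewrite -ler_pdivlMl// mulr1 (le_trans xs).
Qed.

End finite_type_phase.

(** * Curves of finite type and polynomial curves *)

Section smooth_on.
Context {R : realType}.
Implicit Types (a b s t c e : R).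

(** In the interior the restricted limit is an ordinary two-sided derivative; at the end points it
    still yields continuity. *)
Lemma diff_quotient_C1_on a b (h D : R -> R) : a < b ->
  (forall t, a <= t <= b ->
    diff_quotient h t s @[s --> within `[a, b] t^'] --> D t) ->
  C1_on a b h D.
Proof.
move=> ab hD.
have eps t e : a <= t <= b -> 0 < e -> exists2 dlt, 0 < dlt &
    forall s, a <= s <= b -> s != t -> `|t - s| < dlt ->
      `|D t - (s - t)^-1 * (h s - h t)| < e.
  move=> Iab e0; have := hD t Iab => /cvgrPdist_lt/(_ e e0).
  rewrite /prop_near1 /within/= /dnbhs /within/= => /nbhs_ballP[dlt /= dlt0 H].
  by exists dlt => // s Is st sd; apply: (H s); rewrite //= in_itv.
split.
  apply/subspace_continuousP => t /=; rewrite in_itv/= => It.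
  apply/cvgrPdist_lt => e e0; have [dlt dlt0 H] := eps t 1 It ltr01.
  have D0 : 0 < `|D t| + 1 by rewrite ltr_wpDl.
  have : \forall s \near t, `|t - s| < Num.min dlt (e / (`|D t| + 1)).
    by apply: nbhsx_ballx; rewrite lt_min dlt0 divr_gt0.
  rewrite /prop_near1 /within/=; apply: filterS => s.
  rewrite lt_min => /andP[sd se]; rewrite in_itv/= => Is.
  have [->|st] := eqVneq s t; first by rewrite subrr normr0.
  have st0 : s - t != 0 by rewrite subr_eq0.
  have {H} := H s Is st sd; rewrite distrC => H.
  have -> : h t - h s = (t - s) * ((s - t)^-1 * (h s - h t)).
    by rewrite -(opprB s t) mulNr mulrA divff// mul1r opprB.
  rewrite normrM (@le_lt_trans _ _ (`|t - s| * (`|D t| + 1)))//; last first.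
    by rewrite -ltr_pdivlMr.
  rewrite ler_wpM2l// -[X in `|X|](subrK (D t)) addrC (le_trans (ler_normD _ _))//.
  by rewrite lerD2l ltW.
move=> t /andP[ta tb]; have It : a <= t <= b by rewrite !ltW.
suff dh : (fun x : R => x^-1 *: (h (x *: 1 + t) - h t)) @ 0^' --> D t.
  by apply: DeriveDef; [apply/cvg_ex; exists (D t)|exact: (cvg_lim _ dh)].
apply/cvgrPdist_lt => e e0; have [dlt dlt0 H] := eps t e It e0.
near=> x.
have x0 : x != 0 by near: x; exact: nbhs_dnbhs_neq.
have xd : `|x| < Num.min dlt (Num.min (t - a) (b - t)).
  by near: x; apply: dnbhs0_lt; rewrite !lt_min dlt0 !subr_gt0 ta.
rewrite !lt_min in xd; case/and3P: xd => xd xa xb.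
rewrite [x *: 1]mulr1; have := H (x + t); rewrite addrK; apply.
- move: xa xb; rewrite !ltr_norml => /andP[xa _] /andP[_ xb].
  by move: xa xb; clear; lra.
- by rewrite -subr_eq0 addrK.
- by rewrite opprD addrCA subrr addr0 normrN.
Unshelve. all: by end_near. Qed.

Lemma dotp_continuous d (theta : 'rV[R]_d) :
  continuous (fun v : 'rV[R]_d => dotp v theta).
Proof.
rewrite /dotp; apply: continuous_big => [|i _ v]; first exact: add_continuous.
apply: (@continuousM R _ (fun v : 'rV[R]_d => v ord0 i)); last exact: cst_continuous.
exact: coord_continuous.
Qed.

Lemma dotpBl d (u v w : 'rV[R]_d) : dotp (u - v) w = dotp u w - dotp v w.
Proof. by rewrite /dotp -sumrB; apply: eq_bigr => i _; rewrite !mxE mulrBl. Qed.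

Lemma dotp_delta d (v : 'rV[R]_d) i : dotp v (delta_mx ord0 i) = v ord0 i.
Proof.
rewrite /dotp (bigD1 i)//= mxE !eqxx mulr1 big1 ?addr0// => j /negbTE ji.
by rewrite mxE ji andbF mulr0.
Qed.

Lemma dotpDl d (u v w : 'rV[R]_d) : dotp (u + v) w = dotp u w + dotp v w.
Proof. by rewrite /dotp -big_split; apply: eq_bigr => i _; rewrite mxE mulrDl. Qed.

Lemma dotpZl d c (u w : 'rV[R]_d) : dotp (c *: u) w = c * dotp u w.
Proof. by rewrite /dotp mulr_sumr; apply: eq_bigr => i _; rewrite mxE -mulrA. Qed.

Lemma dotpC d (u w : 'rV[R]_d) : dotp u w = dotp w u.
Proof. by apply: eq_bigr => i _; rewrite mulrC. Qed.

Lemma smooth_on_C1 d a b (gam : R -> 'rV[R]_d) (theta : 'rV[R]_d) n : a < b ->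
  smooth_on `[a, b] gam ->
  C1_on a b (fun t => dotp (deriven_on `[a, b] n gam t) theta)
            (fun t => dotp (deriven_on `[a, b] n.+1 gam t) theta).
Proof.
move=> ab sgam; apply: diff_quotient_C1_on => // t It.
have {sgam} : cvg (diff_quotient (deriven_on `[a, b] n gam) t s
    @[s --> within `[a, b] t^']) by apply: sgam; rewrite /= in_itv.
rewrite /=; set f := deriven_on _ _ _ => cf.
have : (fun v => dotp v theta) (diff_quotient f t s)
    @[s --> within `[a, b] t^'] --> dotp (derive_on `[a, b] f t) theta.
  have c1 : diff_quotient f t s @[s --> within `[a, b] t^'] --> derive_on `[a, b] f t := cf.
  have c2 := @dotp_continuous d theta (derive_on `[a, b] f t).
  exact: (cvg_comp _ _ c1 c2).
apply: cvg_trans; apply: near_eq_cvg; near=> s.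
by rewrite /diff_quotient dotpZl dotpBl.
Unshelve. all: by end_near. Qed.

Lemma C1_on_bounded a b (f : R -> R) : a <= b -> {within `[a, b], continuous f} ->
  exists2 M, 0 < M & forall t, a <= t <= b -> `|f t| <= M.
Proof.
move=> ab cf; have [c _ cmax] := EVT_max ab cf; have [e _ emin] := EVT_min ab cf.
exists (`|f c| + `|f e| + 1) => [|t It]; first by rewrite ltr_wpDl.
have It' : t \in `[a, b] by rewrite in_itv.
have := cmax t It'; have := emin t It'; rewrite ler_norml.
have := ler_norm (f c); have := ler_norm (- f e); rewrite normrN.
have := normr_ge0 (f c); have := normr_ge0 (f e).
by move=> ? ? ? ? ? ?; apply/andP; split; lra.
Qed.

Lemma sphere_coord d (theta : 'rV[R]_d) i : sphere theta -> `|theta ord0 i| <= 1.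
Proof.
move=> /(congr1 (fun x => x ^+ 2)); rewrite /enorm expr1n sqr_sqrtr; last first.
  by apply: sumr_ge0 => j _; rewrite -expr2 sqr_ge0.
move=> E; rewrite -(@ler_pXn2r _ 2)// ?nnegrE// expr1n real_normK ?num_real//.
rewrite -E /dotp (bigD1 i)//= -expr2 lerDl.
by apply: sumr_ge0 => j _; rewrite -expr2 sqr_ge0.
Qed.

Lemma deriven_on_bounded d a b (gam : R -> 'rV[R]_d) n : a < b ->
  smooth_on `[a, b] gam ->
  exists2 M, 0 < M & forall t i, a <= t <= b ->
    `|deriven_on `[a, b] n gam t ord0 i| <= M.
Proof.
move=> ab sgam.
have /choice[M HM] i : exists M, 0 < M /\ forall t, a <= t <= b ->
    `|deriven_on `[a, b] n gam t ord0 i| <= M.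
  have [cf _] := smooth_on_C1 (delta_mx ord0 i) n ab sgam.
  have [M M0 H] := C1_on_bounded (ltW ab) cf; exists M; split=> // t /H.
  by rewrite dotp_delta.
exists (1 + \sum_i M i).
  by rewrite ltr_wpDr// sumr_ge0// => i _; have [/ltW] := HM i.
move=> t i It; have [_ /(_ t It)/le_trans] := HM i; apply.
rewrite (bigD1 i)//= addrCA lerDl addr_ge0// sumr_ge0// => j _.
by have [/ltW] := HM j.
Qed.

Lemma dotp_le d (u v : 'rV[R]_d) c e : (forall i, `|u ord0 i| <= c) ->
  (forall i, `|v ord0 i| <= e) -> `|dotp u v| <= d%:R * (c * e).
Proof.
move=> uc ve; apply: le_trans (ler_norm_sum _ _ _) _.
have -> : d%:R * (c * e) = \sum_(i < d) c * e.
  by rewrite sumr_const card_ord mulr_natl.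
by apply: ler_sum => i _; rewrite normrM ler_pM.
Qed.

End smooth_on.

Section curve_type.
Context {R : realType}.
Implicit Types (a b s t c e : R).

Lemma sphere_compact d : compact (@sphere R d).
Proof.
have cn : continuous (@enorm R d).
  move=> u; apply: (@continuous_comp _ _ _ (fun u => dotp u u) (@Num.sqrt R)).
    rewrite /dotp; apply: continuous_big => [|i _ v]; first exact: add_continuous.
    by apply: (@continuousM R _ (fun v : 'rV[R]_d => v ord0 i));
      exact: coord_continuous.
  exact: sqrt_continuous.
have cube := @rV_compact R d (fun=> `[-1, 1]%classic)
  (fun=> @segment_compact R (-1) 1).
apply: (subclosed_compact _ cube) => [|v /sphere_coord v1 i /=].
- have -> : @sphere R d = @enorm R d @^-1` [set 1] by [].
  by apply: closed_comp; [move=> x _; exact: cn|exact: closed_eq].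
- by rewrite in_itv/= -ler_norml.
Qed.

Lemma dotp_continuous_at d a b (gam : R -> 'rV[R]_d) n s0 (theta0 : 'rV[R]_d) e :
  a < b -> smooth_on `[a, b] gam -> a <= s0 <= b -> sphere theta0 -> 0 < e ->
  exists2 rho : R, 0 < rho & forall t (theta : 'rV[R]_d), a <= t <= b -> `|t - s0| <= rho ->
    (forall i, `|theta ord0 i - theta0 ord0 i| <= rho) ->
    `|dotp (deriven_on `[a, b] n gam t) theta -
      dotp (deriven_on `[a, b] n gam s0) theta0| <= e.
Proof.
move=> ab sgam Is0 St0 e0.
have [M M0 HM] := deriven_on_bounded n ab sgam.
have [M' M0' HM'] := deriven_on_bounded n.+1 ab sgam.
have K0 : 0 < d%:R * M + d%:R * M' + 1 by rewrite ltr_wpDl// addr_ge0// mulr_ge0// ltW.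
exists (e / (d%:R * M + d%:R * M' + 1)); first exact: divr_gt0.
set rho := e / _; have rho0 : 0 < rho by exact: divr_gt0.
move=> t theta It ts tt0.
rewrite -(subrKA (dotp (deriven_on `[a, b] n gam t) theta0)).
apply: le_trans (ler_normD _ _) _.
have P1 : `|dotp (deriven_on `[a, b] n gam t) theta -
    dotp (deriven_on `[a, b] n gam t) theta0| <= d%:R * (M * rho).
  rewrite dotpC (dotpC _ theta0) -dotpBl dotpC; apply: dotp_le => i; first exact: HM.
  by rewrite !mxE; exact: tt0.
have P2 : `|dotp (deriven_on `[a, b] n gam t) theta0 -
    dotp (deriven_on `[a, b] n gam s0) theta0| <= d%:R * (M' * 1) * `|t - s0|.
  apply: (C1_on_lip_norm (smooth_on_C1 theta0 n ab sgam) Is0 It) => x /andP[/ltW ax /ltW xb] _.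
  apply: dotp_le => i; [by apply: HM'; rewrite ax|exact: sphere_coord].
apply: le_trans (lerD P1 P2) _.
have P3 : d%:R * (M' * 1) * `|t - s0| <= d%:R * M' * rho.
  by rewrite mulr1 ler_wpM2l// mulr_ge0// ltW.
apply: le_trans (lerD (lexx _) P3) _.
have -> : e = (d%:R * M + d%:R * M' + 1) * rho by rewrite mulrC divfK// gt_eqF.
by rewrite mulrA -mulrDl ler_wpM2r ?(ltW rho0)// lerDl.
Qed.

(** The single integer [N] bounds the order and, through [1 / N.+1], gives both the lower bound and
    the radius. The claim thus weakens as [N] grows, and compactness of the product of [[a, b]] and
    the sphere applies to it as a property of all large [N]. *)
Lemma finite_type_uniform d a b (gam : R -> 'rV[R]_d) : a < b ->
  smooth_on `[a, b] gam -> finite_type `[a, b] gam ->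
  exists N : nat, forall (theta : 'rV[R]_d) s, sphere theta -> a <= s <= b ->
    exists2 n, (1 <= n <= N)%N &
      let phi t := dotp (deriven_on `[a, b] n gam t) theta in
      (forall t, a <= t <= b -> `|t - s| <= N.+1%:R^-1 -> N.+1%:R^-1 <= phi t) \/
      (forall t, a <= t <= b -> `|t - s| <= N.+1%:R^-1 -> phi t <= - N.+1%:R^-1).
Proof.
move=> ab sgam ftg.
pose P (N : nat) (x : R * 'rV[R]_d) := exists2 n, (1 <= n <= N)%N &
      let phi t := dotp (deriven_on `[a, b] n gam t) x.2 in
      (forall t, a <= t <= b -> `|t - x.1| <= N.+1%:R^-1 -> N.+1%:R^-1 <= phi t) \/
      (forall t, a <= t <= b -> `|t - x.1| <= N.+1%:R^-1 -> phi t <= - N.+1%:R^-1).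
have cK : compact (`[a, b] `*` @sphere R d).
  by apply: compact_setX; [exact: segment_compact|exact: sphere_compact].
suff [N _ /(_ N (leqnn N)) H] : \forall N \near \oo, `[a, b] `*` @sphere R d `<=` P N.
  by exists N => theta s Sth Is; apply: (H (s, theta)); split; rewrite //= in_itv.
apply: ((compact_near_coveringP _).1 cK) => -[s0 theta0] [/= + S0].
rewrite in_itv/= => Is0.
have [n n1 phi0] := ftg s0 theta0 Is0 S0.
set p := dotp _ _ in phi0.
have e0 : 0 < `|p| / 2 by rewrite divr_gt0// normr_gt0.
have [rho rho0 H] := dotp_continuous_at n ab sgam Is0 S0 e0.
have r0 : 0 < Num.min (rho / 2) (`|p| / 2) by rewrite lt_min e0 divr_gt0.
exists (ball (s0, theta0) (rho / 2),
    [set N : nat | (n <= N)%N && (N.+1%:R^-1 < Num.min (rho / 2) (`|p| / 2))]).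
  split; first by apply: nbhsx_ballx; exact: divr_gt0.
  near=> N => /=; apply/andP; split; near: N; first exact: nbhs_infty_ge.
  exact: (near_infty_natSinv_lt (PosNum r0)).
move=> [[s theta] N] /= [[bs [_ bt]] /andP[nN]]; rewrite lt_min => /andP[Nr Np].
exists n; first by rewrite n1.
have near_p t : a <= t <= b -> `|t - s| <= N.+1%:R^-1 ->
    `|dotp (deriven_on `[a, b] n gam t) theta - p| <= `|p| / 2.
  move=> It ts; apply: H => //.
    rewrite -(subrKA s) (le_trans (ler_normD _ _))// [leRHS](splitr rho).
    apply: lerD; first by rewrite ltW// (le_lt_trans ts).
    by rewrite distrC ltW//; exact: bs.
  move=> i; rewrite ltW// distrC (@lt_trans _ _ (rho / 2))//.
    exact: bt.
  by rewrite ltr_pdivrMr// mulr2n mulrDr mulr1 ltrDl.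
have [p0|p0] := ltP 0 p.
  left => t It ts; have := near_p t It ts; rewrite (gtr0_norm p0) in Np *.
  rewrite ler_norml /= => /andP[+ _]; move: Np; move: (dotp _ theta) (N.+1%:R^-1).
  by move: (p) => x y z; clear; lra.
have {p0}p0 : p < 0 by rewrite lt_neqAle phi0.
right=> t It ts; have := near_p t It ts; rewrite (ltr0_norm p0) in Np *.
rewrite ler_norml /= => /andP[_ +]; move: Np; move: (dotp _ theta) (N.+1%:R^-1).
by move: (p) => x y z; clear; lra.
Unshelve. all: by end_near. Qed.

Lemma C1_on_vanish a b (D D' : R -> R) : C1_on a b D D' ->
  (forall t, a < t < b -> D t = 0) -> forall t, a < t < b -> D' t = 0.
Proof.
move=> [_ dD] D0 t It.
have : is_derive t (1 : R) D 0.
  apply: (@near_eq_is_derive R R R (cst (0 : R))).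
  have : t \in `]a, b[ by rewrite in_itv.
  move=> /near_in_itvoo; apply: filterS => x.
  by rewrite in_itv => /D0.
by move=> h; have := dD t It => h'; rewrite -(@derive_val _ _ _ _ _ _ _ h') (@derive_val _ _ _ _ _ _ _ h).
Qed.

(** The relative derivatives agree with those of the polynomials: the difference [D] vanishes in the
    interior by induction on the order, and at the end points because it is constant on the closed
    interval. *)
Lemma polynomial_curve_deriven d a b (gam : R -> 'rV[R]_d) : a < b ->
  smooth_on `[a, b] gam -> polynomial_curve `[a, b] gam ->
  exists N : nat, forall theta n t, (N <= n)%N -> a <= t <= b ->
    dotp (deriven_on `[a, b] n gam t) theta = 0.
Proof.
move=> ab sgam [p gp]; exists (\max_i size (p i)) => theta n t Nn It.
pose q := \sum_i theta ord0 i *: p i.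
pose D n t := dotp (deriven_on `[a, b] n gam t) theta - (q^`(n)).[t].
have CD k : C1_on a b (D k) (D k.+1).
  apply: C1_onB; first exact: smooth_on_C1.
  split; first by apply: continuous_subspaceT => x; exact: continuous_horner.
  by move=> x _; rewrite derivnS; exact: is_derive_poly.
have D0 k x : a < x < b -> D k x = 0.
  elim: k x => [|k IH] x Ix; last exact: (C1_on_vanish (CD k)).
  rewrite /D derivn0 /q horner_sum /dotp; apply/eqP; rewrite subr_eq0; apply/eqP.
  apply: eq_bigr => i _; rewrite hornerZ mulrC -gp//= in_itv/=.
  by case/andP: Ix => /ltW -> /ltW ->.
have DE : D n t = 0.
  have Im : a < (a + b) / 2 < b by apply/andP; split; move: ab; clear; lra.
  have Im' : a <= (a + b) / 2 <= b by case/andP: Im => /ltW -> /ltW ->.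
  rewrite -(D0 n _ Im); apply/eqP; rewrite -subr_eq0 -normr_le0.
  have := C1_on_lip_norm (c := 0) (CD n) Im' It; rewrite mul0r; apply => x Ix _.
  by rewrite D0// normr0.
move/eqP: DE; rewrite subr_eq0 => /eqP ->.
rewrite derivn_poly0 ?horner0// (leq_trans _ Nn)// (leq_trans (size_sum _ _ _))//.
apply/bigmax_leqP => i _; rewrite (leq_trans (size_scale_leq _ _))//.
exact: leq_bigmax.
Qed.
End curve_type.

(** * The dichotomy for the Fourier transform of the curve measure *)

Section fourier_bound.
Context {R : realType}.
Implicit Types (a b s t c e r lam B : R).

(** The constant shift [e] is seen at order 0 only. With [e = - (pi / 2)] the cosine becomes a sine,
    so cosine integrals cover both parts of the exponential. *)
Definition phase d a b (gam : R -> 'rV[R]_d) (theta : 'rV[R]_d) r e n t : R :=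
  r * dotp (deriven_on `[a, b] n gam t) theta + (if n == 0%N then e else 0).

Lemma phaseS d a b (gam : R -> 'rV[R]_d) theta r e n t :
  phase a b gam theta r e n.+1 t =
  r * dotp (deriven_on `[a, b] n.+1 gam t) theta.
Proof. by rewrite /phase addr0. Qed.

Lemma phase_C1 d a b (gam : R -> 'rV[R]_d) theta r e n : a < b ->
  smooth_on `[a, b] gam ->
  C1_on a b (phase a b gam theta r e n) (phase a b gam theta r e n.+1).
Proof.
move=> ab sgam.
have C := C1_onD (C1_onM (C1_on_cst a b r) (smooth_on_C1 theta n ab sgam))
                 (C1_on_cst a b (if n == 0%N then e else 0)).
by apply: C1_on_ext C => t _; rewrite phaseS /= mulr0 !addr0.
Qed.

(** The same [L] serves a bound when some derivative is large at every point, and the spreading of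
    smallness when none is large at [s]. A polynomial curve may lie in a hyperplane, so it is
    treated apart: its derivative of order [L.+1] vanishes. *)
Lemma phase_nonconstant d a b (gam : R -> 'rV[R]_d) K : a < b ->
  smooth_on `[a, b] gam ->
  finite_type `[a, b] gam \/ polynomial_curve `[a, b] gam ->
  exists L C, [/\ (K <= L)%N, 0 <= C & forall theta r lam,
    sphere theta -> 1 <= r -> 1 <= lam ->
    (forall e psi dpsi P B,
      oscillatory a b (phase a b gam theta r e) psi dpsi P B ->
      (forall s, a <= s <= b -> exists2 k, (1 <= k <= L)%N &
        lam ^+ k < `|phase a b gam theta r 0 k s|) ->
      `|P b - P a| <= C * (B / lam)) /\
    (forall s t, a <= s <= b -> a <= t <= b -> `|t - s| <= lam^-1 ->
      (forall k, (1 <= k <= L)%N -> `|phase a b gam theta r 0 k s| <= lam ^+ k) ->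
      forall k, (1 <= k <= L)%N -> `|phase a b gam theta r 0 k t| <= C * lam ^+ k)].
Proof.
move=> ab sgam [ft|pc].
- have [N HN] := finite_type_uniform ab sgam ft.
  pose L := maxn N K.
  have /choice[M HM] : forall n, exists M, 0 < M /\ forall t i, a <= t <= b ->
      `|deriven_on `[a, b] n gam t ord0 i| <= M.
    by move=> n; have [M M0 HM] := deriven_on_bounded n ab sgam; exists M.
  pose M' := 1 + \sum_(i < L.+2) d%:R * M i.
  have M0 i : 0 <= d%:R * M i by rewrite mulr_ge0//; have [/ltW] := HM i.
  have M'1 : 1 <= M' by rewrite lerDl sumr_ge0.
  have M'0 : 0 < M' := lt_le_trans ltr01 M'1.
  have phM theta r e t k : sphere theta -> 0 < r -> (k <= L)%N -> a <= t <= b ->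
      `|phase a b gam theta r e k.+1 t| <= M' * r.
    move=> St r0 kL It; rewrite phaseS normrM gtr0_norm// mulrC ler_wpM2r ?(ltW r0)//.
    have [_ HMk] := HM k.+1.
    apply: (@le_trans _ _ (d%:R * (M k.+1 * 1))).
      by apply: dotp_le => i; [exact: HMk|exact: sphere_coord].
    have kL' : (k.+1 < L.+2)%N by rewrite !ltnS.
    rewrite mulr1 /M' (bigD1 (Ordinal kL'))//= addrCA lerDl addr_ge0//.
    by rewrite sumr_ge0.
  pose c : R := N.+1%:R^-1.
  have c0 : 0 < c by rewrite invr_gt0.
  have [C C0 HC] := finite_type_bound L (ltW ab) c0 M'0 c0.
  exists L, (C + (M' / c + L%:R)); split.
  + exact: leq_maxr.
  + by rewrite !addr_ge0// divr_ge0// ltW.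
  move=> theta r lam St r1 lam1.
  have r0 : 0 < r := lt_le_trans ltr01 r1.
  have lam0 : 0 < lam := lt_le_trans ltr01 lam1.
  have phc e s : a <= s <= b -> exists2 n, (1 <= n <= L)%N &
    (forall t, a <= t <= b -> `|t - s| <= c -> c * r <= phase a b gam theta r e n t) \/
    (forall t, a <= t <= b -> `|t - s| <= c -> phase a b gam theta r e n t <= - (c * r)).
    move=> Is; have [[//|n] /andP[n1 nN] Hn] := HN theta s St Is.
    exists n.+1; first by rewrite /L leq_max nN.
    case: Hn => Hn; [left|right] => t It ts; rewrite phaseS (mulrC c).
      by rewrite ler_wpM2l ?(ltW r0)// Hn.
    by rewrite -mulrN ler_wpM2l ?(ltW r0)// Hn.
  split=> [e psi dpsi P B H Hlam|s t Is It ts Hlam k kL].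
    have B0 := oscillatory_ge0 H.
    apply: le_trans (HC _ _ _ _ _ r lam H r0 lam1 _ (phc e) _) _.
    * by move=> t k kL It; exact: phM.
    * by move=> s /Hlam[[//|k] kL Hk]; exists k.+1.
    * rewrite ler_wpM2r// ?divr_ge0 ?(ltW lam0)// lerDl addr_ge0// divr_ge0// ltW//.
  apply: le_trans (@derivatives_near _ a b (phase a b gam theta r 0) (M' / c) lam s t L
    Is It _ lam0 _ ts Hlam _ k _) _.
  * by move=> n; exact: phase_C1.
  * by rewrite divr_ge0// ltW.
  * move=> x Ix; apply: le_trans (phM _ _ _ _ _ St r0 (leqnn L) Ix) _.
    rewrite -mulrA ler_wpM2l ?(ltW M'0)//.
    (* At [s] some derivative is at least [c * r] by finite type and at most a power of [lam] by
       assumption; this bounds [r], hence the top derivative. *)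
    have [[//|n] nL Hn] := phc 0 s Is.
    rewrite ler_pdivlMl//; apply: (@le_trans _ _ (lam ^+ n.+1)).
      apply: le_trans (Hlam n.+1 nL).
      have ss : `|s - s| <= c by rewrite subrr normr0 ltW.
      by rewrite ler_normr lerNr; case: Hn => /(_ s Is ss) ->; rewrite ?orbT.
    by rewrite ler_weXn2l// leqW//; case/andP: nL.
  * by case/andP: kL => -> /leqW.
  * by rewrite ler_wpM2r ?exprn_ge0 ?(ltW lam0)// lerDr.
- have [N HN] := polynomial_curve_deriven ab sgam pc.
  (* With [n = maxn N K], [L] is the last order [n.+1] and [L.+1] the order [n.+2] whose sign
     [oscillatory_bound] asks for. *)
  pose L := (maxn N K).+1.
  have ph0 theta r e t : a <= t <= b -> phase a b gam theta r e L.+1 t = 0.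
    move=> It; rewrite phaseS HN ?mulr0//.
    by rewrite /L (leq_trans (leq_maxl N K))// -addn2 leq_addr.
  have [C C0 HC] := oscillatory_bound (b - a) (maxn N K).
  exists L, (C + L%:R); split.
  + by rewrite /L ltnW// ltnS leq_maxr.
  + by rewrite addr_ge0.
  move=> theta r lam St r1 lam1.
  have lam0 : 0 < lam := lt_le_trans ltr01 lam1.
  split=> [e psi dpsi P B H Hlam|s t Is It ts Hlam k kL].
    have B0 := oscillatory_ge0 H.
    apply: le_trans (HC _ _ _ _ _ _ _ lam H (lexx _) lam0 _ _) _.
    * by left=> t It; rewrite ph0.
    * by move=> s /Hlam[[//|k] kL Hk]; exists k.+1.
    * by rewrite ler_wpM2r// ?divr_ge0 ?(ltW lam0)// lerDl.
  apply: le_trans (@derivatives_near _ a b (phase a b gam theta r 0) 0 lam s t L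
    Is It _ lam0 (lexx _) ts Hlam _ k _) _.
  * by move=> n; exact: phase_C1.
  * by move=> x Ix; rewrite ph0// normr0 mul0r.
  * by case/andP: kL => -> /leqW.
  * by rewrite add0r ler_wpM2r ?exprn_ge0 ?(ltW lam0)// lerDr.
Qed.

Lemma primitive_C1 a b (f : R -> R) : a < b -> {within `[a, b], continuous f} ->
  C1_on a b (fun x => \int[lebesgue_measure]_(t in `[a, x]) f t) f.
Proof.
move=> ab cf.
have fi : (@lebesgue_measure R).-integrable `[a, b] (EFin \o f).
  by apply: continuous_compact_integrable => //; exact: segment_compact.
split; first exact: (parameterized_integral_continuous (ltW ab) fi).
move=> t /andP[ta tb].
have [|dF F'] := continuous_FTC1_closed tb fi ta.
  have : {within `]a, b[, continuous f}.
    by apply: continuous_subspaceW cf; exact: subset_itv_oo_cc.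
  rewrite continuous_open_subspace; last exact: interval_open.
  by apply; rewrite inE/= in_itv/= ta.
by apply: DeriveDef; [exact: dF|rewrite -derive1E].
Qed.

(** Expansion into real and imaginary parts with [sin x = cos (x - pi / 2)]: four real integrals,
    all of the form covered by [oscillatory]. *)
Lemma fourierE d a b (gam : R -> 'rV[R]_d) (chi : R -> R[i]) theta r : a < b ->
  smooth_on `[a, b] gam ->
  {within `[a, b], continuous (fun t => complex.Re (chi t))} ->
  {within `[a, b], continuous (fun t => complex.Im (chi t))} ->
  let J e psi := \int[lebesgue_measure]_(t in `[a, b])
    (cos (phase a b gam theta r e 0 t) * psi t) in
  fourier `[a, b] gam chi (r *: theta) =
  Complex (J 0 (fun t => complex.Re (chi t)) +
           J (- (pi / 2)) (fun t => complex.Im (chi t)))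
          (J 0 (fun t => complex.Im (chi t)) -
           J (- (pi / 2)) (fun t => complex.Re (chi t))).
Proof.
move=> ab sgam cr ci J.
have Ji e (psi : R -> R) : {within `[a, b], continuous psi} ->
    (@lebesgue_measure R).-integrable `[a, b]
      (fun t => (cos (phase a b gam theta r e 0 t) * psi t)%:E).
  move=> cpsi; apply: continuous_compact_integrable; first exact: segment_compact.
  have [cc _] := C1_on_comp (@is_derive_cos R) (phase_C1 theta r e 0 ab sgam).
  by move=> t; apply: continuousM; [exact: cc|exact: cpsi].
rewrite /fourier /cintegral; congr Complex.
  rewrite /J -RintegralD//; [|exact: Ji|exact: Ji].
  apply: eq_Rintegral => t _; rewrite /phase/= addr0 dotpZl dotpC.
  case: (chi t) => x y /=; rewrite cosN sinN cosB cos_pihalf sin_pihalf.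
  by rewrite mulr0 add0r mulr1 mulNr opprK.
rewrite /J -RintegralB//; [|exact: Ji|exact: Ji].
apply: eq_Rintegral => t _; rewrite /phase/= addr0 dotpZl dotpC.
case: (chi t) => x y /=; rewrite cosN sinN cosB cos_pihalf sin_pihalf.
by rewrite mulr0 add0r mulr1 mulNr.
Qed.

Lemma normc_le (z : R[i]) c e : `|complex.Re z| <= c -> `|complex.Im z| <= e ->
  ComplexField.Normc.normc z <= c + e.
Proof.
case: z => x y /= xc ye.
have c0 : 0 <= c := le_trans (normr_ge0 _) xc.
have e0 : 0 <= e := le_trans (normr_ge0 _) ye.
rewrite -[leRHS]ger0_norm ?addr_ge0// -sqrtr_sqr ler_wsqrtr//.
rewrite -(real_normK (num_real x)) -(real_normK (num_real y)) sqrrD.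
have hx : `|x| ^+ 2 <= c ^+ 2 by rewrite lerXn2r// nnegrE.
have hy : `|y| ^+ 2 <= e ^+ 2 by rewrite lerXn2r// nnegrE.
have : 0 <= c * e *+ 2 by rewrite mulrn_wge0// mulr_ge0.
by move: (c * e *+ 2) hx hy => w; clear; lra.
Qed.

Lemma fourier_dichotomy d a b (gam : R -> 'rV[R]_d) (chi : R -> R[i]) K :
  a < b -> smooth_on `[a, b] gam -> smooth_cplx chi ->
  finite_type `[a, b] gam \/ polynomial_curve `[a, b] gam ->
  exists2 C, 0 < C & forall (theta : 'rV[R]_d) r, sphere theta -> 1 <= r ->
    let f := ComplexField.Normc.normc (fourier `[a, b] gam chi (r *: theta)) in
    f <= C /\
    forall lam, 1 <= lam -> f <= C / lam \/
      exists2 s, a <= s <= b & forall t, a <= t <= b -> `|t - s| <= lam^-1 ->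
        forall k, (1 <= k <= K)%N ->
          r * `|dotp (deriven_on `[a, b] k gam t) theta| <= C * lam ^+ k.
Proof.
move=> ab sgam schi ftp.
have C1chi (h : R -> R) : (forall n t, derivable (derive1n n h) t 1) ->
    exists dh B, [/\ 0 < B, C1_on a b h dh &
    forall t, a <= t <= b -> `|h t| <= B /\ `|dh t| <= B].
  move=> dh.
  have ch n : {within `[a, b], continuous (derive1n n h)}.
    apply: continuous_subspaceT => t.
    by apply: differentiable_continuous; apply/derivable1_diffP; exact: dh.
  have [B B0 HB] := C1_on_bounded (ltW ab) (ch 0%N).
  have [B' B'0 HB'] := C1_on_bounded (ltW ab) (ch 1%N).
  exists (derive1 h), (B + B'); split; first exact: addr_gt0.
    split; first exact: (ch 0%N).
    move=> t _; apply: DeriveDef; first exact: (dh 0%N).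
    by rewrite derive1E.
  move=> t It; split; first by rewrite (le_trans (HB t It))// lerDl ltW.
  by rewrite (le_trans (HB' t It))// lerDr ltW.
have [dR [BR [BR0 CR HR]]] := C1chi _ (fun n t => (schi n t).1).
have [dI [BI [BI0 CI HI]]] := C1chi _ (fun n t => (schi n t).2).
have [L [C [KL C0 HC]]] := phase_nonconstant K ab sgam ftp.
(* Each of the four integrals is at most [C * B / lam] or, trivially, [(b - a) * B]; one constant
   covers both. *)
pose D := 2 * (C + (b - a)) * (BR + BI).
have ba0 : 0 < b - a by rewrite subr_gt0.
have BRI : 0 <= BR + BI by rewrite addr_ge0// ltW.
have D0 : 0 < D by rewrite mulr_gt0 ?addr_gt0// mulr_gt0// ltr_wpDl.
exists (C + D); first by rewrite ltr_wpDl.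
move=> theta r St r1 f.
pose J e (psi : R -> R) := \int[lebesgue_measure]_(t in `[a, b])
    (cos (phase a b gam theta r e 0 t) * psi t).
have JP e psi dpsi B : C1_on a b psi dpsi ->
    (forall t, a <= t <= b -> `|psi t| <= B /\ `|dpsi t| <= B) ->
    exists P, oscillatory a b (phase a b gam theta r e) psi dpsi P B /\
      J e psi = P b - P a.
  move=> Cpsi HB.
  exists (fun x => \int[lebesgue_measure]_(t in `[a, x])
    (cos (phase a b gam theta r e 0 t) * psi t)); split.
    split => //; first exact: ltW.
      by move=> n; exact: phase_C1.
    apply: primitive_C1 => //.
    have [cc _] := C1_on_comp (@is_derive_cos R) (phase_C1 theta r e 0 ab sgam).
    by case: Cpsi => cpsi _ t; apply: continuousM; [exact: cc|exact: cpsi].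
  by rewrite set_itv1 Rintegral_set1 subr0.
have JB e psi dpsi B : C1_on a b psi dpsi ->
    (forall t, a <= t <= b -> `|psi t| <= B /\ `|dpsi t| <= B) ->
    `|J e psi| <= (b - a) * B.
  move=> Cpsi HB; have [P [H ->]] := JP e _ _ _ Cpsi HB.
  by rewrite mulrC; exact: oscillatory_lip H.
rewrite {}/f (fourierE theta r ab sgam CR.1 CI.1) -/(J _ _) -/(J _ _) -/(J _ _) -/(J _ _).
have Jsum (c : R) : (forall e, `|J e (fun t => complex.Re (chi t))| <= c * BR) ->
    (forall e, `|J e (fun t => complex.Im (chi t))| <= c * BI) ->
    ComplexField.Normc.normc (Complex
      (J 0 (fun t => complex.Re (chi t)) + J (- (pi / 2)) (fun t => complex.Im (chi t)))
      (J 0 (fun t => complex.Im (chi t)) - J (- (pi / 2)) (fun t => complex.Re (chi t))))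
    <= 2 * c * (BR + BI).
  move=> cR cI.
  have -> : 2 * c * (BR + BI) = (c * BR + c * BI) + (c * BI + c * BR).
    by clear; ring.
  apply: normc_le => /=.
    by rewrite (le_trans (ler_normD _ _))// lerD.
  by rewrite (le_trans (ler_normB _ _))// lerD.
split.
  apply: le_trans (Jsum (b - a) _ _) _.
  - by move=> e; apply: JB CR _.
  - by move=> e; apply: JB CI _.
  apply: (@le_trans _ _ D); last by rewrite lerDr.
  by rewrite /D ler_wpM2r// ler_wpM2l// lerDr.
move=> lam lam1; have lam0 : 0 < lam := lt_le_trans ltr01 lam1.
have [HC1 HC2] := HC theta r lam St r1 lam1.
have [Hs|] := pselect (forall s, a <= s <= b -> exists2 k, (1 <= k <= L)%N &
    lam ^+ k < `|phase a b gam theta r 0 k s|).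
  left; apply: le_trans (Jsum (C / lam) _ _) _.
  - move=> e; have [P [H ->]] := JP e _ _ _ CR HR.
    by rewrite mulrAC -mulrA; exact: HC1 H Hs.
  - move=> e; have [P [H ->]] := JP e _ _ _ CI HI.
    by rewrite mulrAC -mulrA; exact: HC1 H Hs.
  have -> : 2 * (C / lam) * (BR + BI) = 2 * C * (BR + BI) / lam by clear; ring.
  rewrite ler_wpM2r ?invr_ge0 ?(ltW lam0)//.
  apply: (@le_trans _ _ D); last by rewrite lerDr.
  by rewrite /D ler_wpM2r// ler_wpM2l// lerDl ltW.
move=> /existsNP[s /not_implyP[Is Hs]]; right; exists s => // t It ts k /andP[k1 kK].
have r0 : 0 < r := lt_le_trans ltr01 r1.
have kL : (1 <= k <= L)%N by rewrite k1 (leq_trans kK).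
have : `|phase a b gam theta r 0 k t| <= C * lam ^+ k.
  apply: (HC2 s t Is It ts _ k kL) => j jL; rewrite leNgt; apply/negP => Hj.
  by apply: Hs; exists j.
case: k k1 {kK kL} => // k _; rewrite phaseS normrM gtr0_norm// => /le_trans; apply.
by rewrite ler_wpM2r ?exprn_ge0 ?(ltW lam0)// lerDl ltW.
Qed.

End fourier_bound.

(** * Measure of intersections of slabs *)

Section lebesgue_rV_theory.
Context {R : realType}.

Lemma lebesgue_measure_shift (c : R) (A : set (measurableTypeR R)) : measurable A ->
  lebesgue_measure ((fun x : measurableTypeR R => (x + c : measurableTypeR R)) @^-1` A) =
  lebesgue_measure A.
Proof.
pose f (x : measurableTypeR R) : measurableTypeR R := x + c.
have mf : measurable_fun setT f by apply: measurable_funD.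
move=> mA; change (pushforward lebesgue_measure f A = lebesgue_measure A).
apply/esym/lebesgue_measure_unique => //= _ [[a b]] _ <-.
rewrite /pushforward.
have -> : f @^-1` `]a, b]%classic = `]a - c, b - c]%classic.
  by apply/seteqP; split => x /=; rewrite !in_itv/= /f ltrBlDr lerBrDr.
rewrite !lebesgue_measure_itv/= !lte_fin ltrD2r; case: ifP => // _.
by rewrite -!EFinB; congr EFin; ring.
Qed.

Lemma measurable_rV_add n (u : 'rV[R]_n) :
  measurable_fun [set: 'rV[R]_n] (fun v => v + u).
Proof.
apply: measurable_fun_rV => i.
under eq_fun do rewrite mxE.
by apply: measurable_funD => //; exact: measurable_rV_coord.
Qed.

Lemma rV_cons_head n (x : R * 'rV[R]_n) : rV_cons x ord0 (lshift n (ord0 : 'I_1)) = x.1.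
Proof. by apply: etrans (row_mxEl _ _ _ _) _; rewrite mxE eqxx mulr1n. Qed.

Lemma rV_cons_tail n (x : R * 'rV[R]_n) j :
  rV_cons x ord0 (rshift 1 j) = x.2 ord0 j.
Proof. exact: row_mxEr. Qed.

Lemma rV_cons_add n (x : R * 'rV[R]_n) (u : 'rV[R]_n.+1) :
  rV_cons x + u = rV_cons (x.1 + (rV_uncons u).1, x.2 + (rV_uncons u).2).
Proof.
apply/rowP => i; rewrite mxE -(splitK (i : 'I_(1 + n))).
case: (fintype.split (i : 'I_(1 + n))) => j /=.
  rewrite (ord1 j) !rV_cons_head /=; congr (_ + u ord0 _).
  exact: val_inj.
by rewrite !rV_cons_tail /= !mxE.
Qed.

(** Uniqueness of the product measure reduces the claim to boxes, thus to the first coordinate and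
    the induction hypothesis. *)
Lemma lebesgue_rV_shift n (u : 'rV[R]_n) (A : set 'rV[R]_n) : measurable A ->
  lebesgue_rV R n ((fun v => v + u) @^-1` A) = lebesgue_rV R n A.
Proof.
elim: n u A => [|n IH] u A mA.
  rewrite (_ : (fun v => v + u) @^-1` A = A)//.
  by apply/seteqP; split=> v /=; rewrite (_ : v + u = v)//; apply/rowP => -[].
rewrite /= /lebesgue_cons /pushforward.
pose g (x : measurableTypeR R * 'rV[R]_n) : measurableTypeR R * 'rV[R]_n :=
  (x.1 + (rV_uncons u).1, x.2 + (rV_uncons u).2).
have mg : measurable_fun setT g.
  apply: measurable_fun_pair.
    by apply: measurable_funD => //; exact: measurable_fst.
  exact: (measurableT_comp (measurable_rV_add _) measurable_snd).
have mC : measurable (@rV_cons R n @^-1` A).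
  by rewrite -[X in measurable X]setTI; exact: measurable_rV_cons.
have -> : @rV_cons R n @^-1` ((fun v => v + u) @^-1` A) =
    g @^-1` (@rV_cons R n @^-1` A).
  by apply/seteqP; split=> x /=; rewrite rV_cons_add.
set m := (lebesgue_measure \x lebesgue_rV R n)%E.
apply/esym; change (m (@rV_cons R n @^-1` A) = pushforward m g (@rV_cons R n @^-1` A)).
apply: product_measure_unique => // B D mB mD; rewrite /pushforward.
transitivity (m
  (((fun x : measurableTypeR R => (x + (rV_uncons u).1 : measurableTypeR R)) @^-1` B)
  `*` ((fun v => v + (rV_uncons u).2) @^-1` D))) => //.
rewrite /m product_measure1E.
- by congr (_ * _)%E; [exact: lebesgue_measure_shift|exact: IH].
- rewrite -[X in measurable X]setTI; apply: measurable_funD => //.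
- by rewrite -[X in measurable X]setTI; exact: measurable_rV_add.
Qed.

Lemma measurable_cube n (Q : R) :
  measurable [set v : 'rV[R]_n | forall i, `|v ord0 i| <= Q].
Proof.
have -> : [set v : 'rV[R]_n | forall i, `|v ord0 i| <= Q] =
    \bigcap_(i in [set: 'I_n]) [set v | `|v ord0 i| <= Q].
  by apply/seteqP; split => [v H i _|v H i]; exact: H.
apply: fin_bigcap_measurable => [|i _]; first exact: finite_finset.
rewrite [X in measurable X](_ : _ =
    (fun v : 'rV[R]_n => v ord0 i) @^-1` `[- Q, Q]%classic); last first.
  by apply/seteqP; split => v /=; rewrite in_itv/= -ler_norml.
by rewrite -[X in measurable X]setTI; exact: measurable_rV_coord.
Qed.

Lemma lebesgue_rV_cube n (Q : R) : exists2 V, 0 <= V &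
  (lebesgue_rV R n [set v : 'rV[R]_n | forall i, (`|v ord0 i| <= Q)%R] <= V%:E)%E.
Proof.
elim: n => [|n [V V0 IH]].
  exists 1 => //=; rewrite diracE; case: (_ \in _) => //.
exists (`|Q| *+ 2 * V); first by rewrite mulr_ge0// mulrn_wge0.
rewrite /= /lebesgue_cons /pushforward.
have -> : @rV_cons R n @^-1` [set v : 'rV[R]_n.+1 | forall i, `|v ord0 i| <= Q] =
    (`[- Q, Q]%classic : set (measurableTypeR R)) `*`
      [set v : 'rV[R]_n | forall i, `|v ord0 i| <= Q].
  apply/seteqP; split => [x H|x [/= + H] i].
    split=> [|i] /=; first by rewrite in_itv/= -ler_norml -(@rV_cons_head n) H.
    by rewrite -rV_cons_tail H.
  rewrite in_itv/= -ler_norml => xQ.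
  rewrite -(splitK (i : 'I_(1 + n))).
  case: (fintype.split (i : 'I_(1 + n))) => j /=; last by rewrite rV_cons_tail.
  by rewrite (ord1 j) rV_cons_head.
rewrite [leLHS]product_measure1E//; last exact: measurable_cube.
rewrite EFinM lee_pmul//.
apply: (@le_trans _ _ (lebesgue_measure (`[- Q, Q]%classic : set R))) => //.
rewrite lebesgue_measure_itv/= lte_fin; case: ifPn => // QQ.
  by rewrite -EFinB lee_fin opprK -mulr2n lerMn2r/= ler_norm.
Qed.

Lemma measurable_dotp_le n (w : 'rV[R]_n) e :
  measurable [set v : 'rV[R]_n | `|dotp w v| <= e].
Proof.
rewrite [X in measurable X](_ : _ =
    (fun v : 'rV[R]_n => dotp w v) @^-1` `[- e, e]%classic); last first.
  by apply/seteqP; split => v /=; rewrite in_itv/= -ler_norml.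
rewrite -[X in measurable X]setTI; exact: measurable_dotp.
Qed.

(* The translates of the slab by [3 * e * i *: u], [i <= 1 / e], are pairwise
   disjoint and contained in [A']. *)
Lemma lebesgue_rV_slab n (A A' : set 'rV[R]_n) (w u : 'rV[R]_n) e :
  measurable A -> measurable A' -> 0 < e -> dotp w u = 1 ->
  (forall v s, A v -> 0 <= s <= 3 -> A' (v + s *: u)) ->
  (lebesgue_rV R n (A `&` [set v | `|dotp w v| <= e]%R) <=
    e%:E * lebesgue_rV R n A')%E.
Proof.
move=> mA mA' e0 wu AA'; set E := A `&` _.
have mE : measurable E by apply: measurableI => //; exact: measurable_dotp_le.
pose N := (Num.truncn e^-1).+1.
pose F (i : nat) := (fun v : 'rV[R]_n => v + - ((3 * e * i%:R) *: u)) @^-1` E.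
have mF i : measurable (F i).
  by rewrite -[X in measurable X]setTI; exact: measurable_rV_add.
have FA' i : (i < N)%N -> F i `<=` A'.
  move=> iN v [Av _]; rewrite -(subrK ((3 * e * i%:R) *: u) v).
  apply: AA' => //; rewrite !mulr_ge0 ?(ltW e0)//=.
  rewrite -mulrA ger_pMr// -ler_pdivlMl// mulr1.
  rewrite ltnS in iN; apply: (@le_trans _ _ (Num.truncn e^-1)%:R).
    by rewrite ler_nat.
  by rewrite truncn_le// invr_ge0 ltW.
have dF i v : F i v -> `|dotp w v - 3 * e * i%:R| <= e.
  move=> [_ /=]; rewrite dotpC dotpBl dotpZl dotpC (dotpC u) wu mulr1.
  by [].
have tF : trivIset setT F.
  apply/trivIsetP => i j _ _ ij; apply/seteqP; split => // v [/dF Fi /dF Fj].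
  have : `|(i%:R - j%:R : R)| < 1.
    rewrite -(ltr_pM2l (x := 3 * e)) ?mulr_gt0// mulr1.
    rewrite -[X in X * `|_|](gtr0_norm (x := 3 * e)) ?mulr_gt0// -normrM.
    move: Fi Fj; rewrite !ler_norml ltr_norml => /andP[a1 a2] /andP[b1 b2].
    move: a1 a2 b1 b2 e0; rewrite mulrBr; move: (3 * e * i%:R) (3 * e * j%:R) (dotp w v).
    by move=> x y z *; apply/andP; split; lra.
  rewrite ltNge; move/negP; apply.
  have [ji|] := ltnP j i.
    rewrite ger0_norm ?subr_ge0 ?ler_nat 1?ltnW//.
    by rewrite lerBrDr nat1r ler_nat.
  rewrite leq_eqVlt (negbTE ij)/= => ji.
  rewrite ler0_norm ?subr_le0 ?ler_nat 1?ltnW// opprB.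
  by rewrite lerBrDr nat1r ler_nat.
have : (lebesgue_rV R n (\big[setU/set0]_(i < N) F i) <= lebesgue_rV R n A')%E.
  apply: le_measure; rewrite ?inE//; first exact: bigsetU_measurable.
  by rewrite -bigcup_mkord; apply: bigcup_sub => i; exact: FA'.
rewrite measure_bigsetU//.
have FE i : lebesgue_rV R n (F i) = lebesgue_rV R n E.
  exact: lebesgue_rV_shift.
rewrite (eq_bigr (fun=> lebesgue_rV R n E)) => [|i _]; last exact: FE.
have sum_cst k (x : \bar R) : (0 <= x)%E -> ((\sum_(i < k) x)%R = k%:R%:E * x)%E.
  move=> x0; elim: k => [|k IH]; first by rewrite big_ord0 mul0e.
  have -> : k.+1%:R%:E = (k%:R%:E + 1%:E)%E :> \bar R by rewrite -EFinD natr1.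
  by rewrite big_ord_recr/= IH [RHS]ge0_muleDl ?mul1e.
rewrite sum_cst// => NE.
apply: (@le_trans _ _ (e%:E * (N%:R%:E * lebesgue_rV R n E))%E); last first.
  by rewrite lee_pmul2l// lte_fin.
rewrite muleA -EFinM -[leLHS]mul1e; apply: lee_wpmul2r => //.
by rewrite lee_fin -ler_pdivrMl// mulr1 ltW// truncnS_gt.
Qed.

End lebesgue_rV_theory.

(** * Intersections of slabs with a dual family *)

Section slabs.
Context {R : realType} (d : nat).
Implicit Types (w u : nat -> 'rV[R]_d) (eps : nat -> R).

Definition slabs w eps m : set 'rV[R]_d :=
  [set v | forall k, (k < m)%N -> `|dotp (w k) v| <= eps k].

Definition cube (Q : R) : set 'rV[R]_d := [set v | forall i, `|v ord0 i| <= Q].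

Lemma measurable_slabs w eps m : measurable (slabs w eps m).
Proof.
elim: m => [|m IH].
  by rewrite (_ : slabs w eps 0 = setT); [|apply/seteqP; split].
rewrite (_ : slabs w eps m.+1 =
  slabs w eps m `&` [set v | `|dotp (w m) v| <= eps m]).
  by apply: measurableI => //; exact: measurable_dotp_le.
apply/seteqP; split => [v H|v [H Hm] k].
  by split => [k km|]; apply: H => //; exact: ltnW.
by rewrite ltnS leq_eqVlt => /predU1P[->//|]; exact: H.
Qed.

Lemma dotp_enorm (v : 'rV[R]_d) : dotp v v = enorm v ^+ 2.
Proof.
by rewrite sqr_sqrtr// sumr_ge0// => i _; rewrite -expr2 sqr_ge0.
Qed.

Lemma sphere_normalize (v : 'rV[R]_d) : 0 < enorm v -> sphere (normalize v).
Proof.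
move=> v0; rewrite /sphere /= /enorm /normalize dotpZl dotpC dotpZl dotp_enorm.
by rewrite expr2 mulKf ?gt_eqF// mulVf ?gt_eqF// sqrtr1.
Qed.

(** The slabs are removed one by one. Translation along [u m] leaves [dotp (w k)] unchanged for
    [k < m], so it preserves the other slabs and only widens the cube, by [3 * B]. *)
Lemma lebesgue_rV_slabs w u eps m (B Q : R) : 0 <= B ->
  (forall k, (k < m)%N -> 0 < eps k) ->
  (forall i j, (i < m)%N -> (j < m)%N -> dotp (w i) (u j) = (i == j)%:R) ->
  (forall j i, (j < m)%N -> `|u j ord0 i| <= B) ->
  (lebesgue_rV R d (cube Q `&` slabs w eps m) <=
    (\prod_(k < m) eps k)%:E * lebesgue_rV R d (cube (Q + m%:R * (3 * B))))%E.
Proof.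
move=> B0 eps0 wu uB.
elim: m Q eps0 wu uB => [|m IH] Q eps0 wu uB.
  rewrite big_ord0 mul1e mul0r addr0 le_measure ?inE//.
    apply: measurableI; [exact: measurable_cube|exact: measurable_slabs].
  exact: measurable_cube.
rewrite (_ : _ `&` _ = (cube Q `&` slabs w eps m) `&`
    [set v | `|dotp (w m) v| <= eps m]); last first.
  apply/seteqP; split => [v [Qv H]|v [[Qv H] Hm]].
    by split; [split=> // k km; apply: H; exact: ltnW|exact: H].
  by split=> // k; rewrite ltnS leq_eqVlt => /predU1P[->//|]; exact: H.
have mS Q' : measurable (cube Q' `&` slabs w eps m).
  by apply: measurableI; [exact: measurable_cube|exact: measurable_slabs].
apply: le_trans (lebesgue_rV_slab (A' := cube (Q + 3 * B) `&` slabs w eps m)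
    (u := u m) (mS _) (mS _) (eps0 m (ltnSn m)) _ _) _.
- by rewrite wu// eqxx.
- move=> v s [Qv Hv] /andP[s0 s3]; split => [i|k km].
    rewrite !mxE (le_trans (ler_normD _ _))// lerD//.
    by rewrite normrM ger0_norm// ler_pM// uB.
  rewrite dotpC dotpDl dotpZl (dotpC (u m)) wu//; last exact: ltnW.
  by rewrite (ltn_eqF km) mulr0 addr0 dotpC Hv.
rewrite big_ord_recr/= (mulrC _ (eps m)) EFinM -muleA.
apply: lee_wpmul2l; first by rewrite lee_fin ltW ?eps0.
apply: le_trans (IH _ _ _ _) _.
- by move=> k km; apply: eps0; exact: ltnW.
- by move=> i j im jm; apply: wu; exact: ltnW.
- by move=> j i jm; apply: uB; exact: ltnW.
rewrite (_ : Q + 3 * B + m%:R * (3 * B) = Q + m.+1%:R * (3 * B))//.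
by rewrite -natr1; ring.
Qed.

(** Slabs are star-shaped about 0, so the cone over their trace on the sphere stays inside them. [V]
    is uniform over all families with dual vectors bounded by [B]. *)
Lemma sphere_measure_slabs m (B : R) : 0 <= B -> exists2 V, 0 <= V &
  forall w u eps, (forall k, (k < m)%N -> 0 < eps k) ->
  (forall i j, (i < m)%N -> (j < m)%N -> dotp (w i) (u j) = (i == j)%:R) ->
  (forall j i, (j < m)%N -> `|u j ord0 i| <= B) ->
  (sphere_measure (slabs w eps m) <= (V * \prod_(k < m) eps k)%:E)%E.
Proof.
move=> B0; have [V V0 HV] := lebesgue_rV_cube d (1 + m%:R * (3 * B)).
exists (d%:R * V) => [|w u eps eps0 wu uB]; first by rewrite mulr_ge0.
rewrite /sphere_measure -mulrA EFinM lee_pmul//.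
apply: (@le_trans _ _ (lebesgue_rV R d (cube 1 `&` slabs w eps m))).
  apply: le_measure; rewrite ?inE.
  - apply: measurableI; first exact: measurable_punctured_ball.
    rewrite -[X in measurable X]setTI; apply: measurable_normalize => //.
    exact: measurable_slabs.
  - by apply: measurableI; [exact: measurable_cube|exact: measurable_slabs].
  - move=> v [/= /andP[v0 v1] Hv].
    have vE : v = enorm v *: normalize v by rewrite scalerA divff ?scale1r// gt_eqF.
    split => [i|k km].
      rewrite vE mxE normrM gtr0_norm// -[leRHS]mul1r ler_pM// ?(ltW v0)//.
      by apply: sphere_coord; exact: sphere_normalize.
    rewrite vE dotpC dotpZl normrM gtr0_norm// dotpC -[leRHS]mul1r ler_pM// ?(ltW v0)//.
    exact: Hv.
apply: le_trans (lebesgue_rV_slabs 1 B0 eps0 wu uB) _.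
rewrite (mulrC V) EFinM; apply: lee_wpmul2l; last exact: HV.
by rewrite lee_fin prodr_ge0// => k _; exact/ltW/eps0.
Qed.
End slabs.

(** * Level sets of the Fourier transform *)

Section dual_family.
Context {R : realType}.

Lemma det_continuous n (T : topologicalType) (M : T -> 'M[R]_n) :
  (forall i j, continuous (fun t => M t i j)) -> continuous (fun t => \det (M t)).
Proof.
move=> cM; rewrite /determinant; apply: continuous_big => [|s _].
  exact: add_continuous.
move=> t; apply: (@continuousM R T (fun=> (-1) ^+ s)
  (fun t => \prod_i M t i (s i))); first exact: cst_continuous.
apply: continuous_big => [|i _ x]; last exact: cM.
by move=> x; exact: mul_continuous.
Qed.

(** If [v] annihilates the Gram matrix, the sum of squares of the entries of [v *m A] is 0. *)
Lemma gram_unitmx m n (A : 'M[R]_(m, n)) : row_free A -> A *m A^T \in unitmx.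
Proof.
move=> fA; rewrite -row_free_unit; apply/inj_row_free => v vA.
apply/eqP; rewrite -(mulmx_free_eq0 _ fA); apply/eqP/rowP => i; rewrite [RHS]mxE.
have wt : (v *m A) *m (v *m A)^T = 0.
  by rewrite trmx_mul mulmxA -[v *m A *m A^T]mulmxA vA mul0mx.
have {wt} := congr1 (fun M : 'M[R]_1 => M ord0 ord0) wt.
rewrite mxE [RHS]mxE => w0.
have sq0 j : (v *m A) ord0 j * (v *m A)^T j ord0 = (v *m A) ord0 j ^+ 2.
  by rewrite [_^T _ _]mxE expr2.
have F0 (j : 'I_n) : true -> 0 <= (v *m A) ord0 j * (v *m A)^T j ord0.
  by move=> _; rewrite sq0 sqr_ge0.
have E : (v *m A) ord0 i * (v *m A)^T i ord0 = 0 := psumr_eq0P F0 w0 isT.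
by apply/eqP; rewrite -sqrf_eq0 -sq0 E.
Qed.

(** The right inverse is [M^T (M M^T)^-1]. The adjugate formula makes its entries continuous, hence
    bounded on the compact interval. *)
Lemma right_inverse_bounded m n a b (M : R -> 'M[R]_(m, n)) : a <= b ->
  (forall i j, {within `[a, b], continuous (fun t => M t i j)}) ->
  (forall t, a <= t <= b -> row_free (M t)) ->
  exists (U : R -> 'M[R]_(n, m)) B, 0 <= B /\ forall t, a <= t <= b ->
    M t *m U t = 1%:M /\ forall i j, `|U t i j| <= B.
Proof.
move=> ab cM fM; pose G t := M t *m (M t)^T.
pose T := subspace (`[a, b]%classic : set R).
have cMT i j : {within `[a, b], continuous (fun t => (M t)^T i j)}.
  rewrite (_ : (fun t => _) = (fun t => M t j i)); first exact: cM.
  by apply/funext => t; rewrite mxE.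
have cG i j : {within `[a, b], continuous (fun t => G t i j)}.
  rewrite (_ : (fun t => _) = (fun t => \sum_k M t i k * (M t)^T k j)); last first.
    by apply/funext => t; rewrite mxE.
  apply: continuous_big => [|k _ x]; first exact: add_continuous.
  apply: (@continuousM R T (fun t => M t i k) (fun t => (M t)^T k j)).
    exact: cM.
  exact: cMT.
have cadj i j : {within `[a, b], continuous (fun t => (\adj (G t)) i j)}.
  rewrite (_ : (fun t => _) =
    (fun t => (-1) ^+ (j + i) * \det (row' j (col' i (G t))))); last first.
    by apply/funext => t; rewrite mxE.
  move=> x; apply: (@continuousM R T (fun=> (-1) ^+ (j + i))
    (fun t => \det (row' j (col' i (G t))))); first exact: cst_continuous.
  apply: (@det_continuous _ T) => i' j'.
  rewrite (_ : (fun t => _) = (fun t => G t (lift j i') (lift i j'))).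
    exact: cG.
  by apply/funext => t; rewrite !mxE.
pose U t := (M t)^T *m ((\det (G t))^-1 *: \adj (G t)).
have dG t : a <= t <= b -> \det (G t) != 0.
  by move=> /fM/gram_unitmx; rewrite unitmxE unitfE.
have cU i j : {within `[a, b], continuous (fun t => U t i j)}.
  rewrite (_ : (fun t => _) =
    (fun t => \sum_k (M t)^T i k * ((\det (G t))^-1 * (\adj (G t)) k j))); last first.
    by apply/funext => t; rewrite mxE; apply: eq_bigr => k _; rewrite [X in _ * X]mxE.
  rewrite continuous_subspace_in => t tI.
  have It : a <= t <= b by move: tI; rewrite inE/= in_itv.
  apply: (@cvg_big _ _ _ _ _ _ _ (nbhs (t : T)) (index_enum 'I_m)
    (fun k (t : T) => (M t)^T i k * ((\det (G t))^-1 * (\adj (G t)) k j))).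
    exact: add_continuous.
  move=> k _; apply: (@continuousM R T (fun t => (M t)^T i k)
    (fun t => (\det (G t))^-1 * (\adj (G t)) k j)); first exact: cMT.
  apply: (@continuousM R T (fun t => (\det (G t))^-1) (fun t => (\adj (G t)) k j)).
    apply: (@continuousV R T (fun t => \det (G t))); first exact: dG.
    exact: (@det_continuous _ T).
  exact: cadj.
have /choice[B HB] : forall ij, exists B, 0 <= B /\
    forall t, a <= t <= b -> `|U t ij.1 ij.2| <= B.
  move=> [i j]; have [B /ltW B0 HB] := C1_on_bounded ab (cU i j).
  by exists B; split.
exists U, (\sum_ij B ij); split; first by apply: sumr_ge0 => ij _; have [] := HB ij.
move=> t It; split.
  rewrite mulmxA -scalemxAr mul_mx_adj scale_scalar_mx mulVf//.
  exact: dG.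
move=> i j; have [_ /(_ t It)/= /le_trans] := HB (i, j); apply.
rewrite (bigD1 (i, j))//= lerDl; apply: sumr_ge0 => ij _.
by have [] := HB ij.
Qed.

End dual_family.

Section level_sets.
Context {R : realType}.

(** The columns of the right inverse are the dual vectors. For [K = d] it is also a left inverse and
    recovers [theta] from its products with the derivatives. *)
Lemma derivatives_dual d K a b (gam : R -> 'rV[R]_d) : a < b ->
  smooth_on `[a, b] gam ->
  (forall t, a <= t <= b ->
    row_free (\matrix_(i < K) deriven_on `[a, b] i.+1 gam t)) ->
  exists (u : R -> nat -> 'rV[R]_d) B, 0 <= B /\ forall t, a <= t <= b ->
    [/\ forall i j, (i < K)%N -> (j < K)%N ->
      dotp (deriven_on `[a, b] i.+1 gam t) (u t j) = (i == j)%:R,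
    forall j i, (j < K)%N -> `|u t j ord0 i| <= B &
    K = d -> forall theta e,
      (forall k, (k < K)%N -> `|dotp (deriven_on `[a, b] k.+1 gam t) theta| <= e) ->
      forall i, `|theta ord0 i| <= d%:R * (B * e)].
Proof.
move=> ab sgam fM; pose M t := \matrix_(i < K) deriven_on `[a, b] i.+1 gam t.
have [|U [B [B0 HU]]] := right_inverse_bounded (M := M) (ltW ab) _ fM.
  move=> i j; have [c _] := smooth_on_C1 (delta_mx ord0 j) i.+1 ab sgam.
  rewrite (_ : (fun t => _) =
    (fun t => dotp (deriven_on `[a, b] i.+1 gam t) (delta_mx ord0 j))) //.
  by apply/funext => t; rewrite mxE dotp_delta.
exists (fun t j => \row_i (if (insub j : option 'I_K) is Some j' then U t i j' else 0)), B.
split => // t It; have [MU UB] := HU t It; split.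
- move=> i j iK jK.
  have := congr1 (fun A : 'M[R]_K => A (Ordinal iK) (Ordinal jK)) MU.
  rewrite mxE [RHS]mxE => <-; apply: eq_bigr => k _.
  by rewrite !mxE insubT.
- by move=> j i jK; rewrite mxE insubT.
move=> Kd; subst K => theta e thee i.
have UM := mulmx1C MU.
have -> : theta ord0 i = \sum_j U t i j * dotp (deriven_on `[a, b] j.+1 gam t) theta.
  have : U t *m (M t *m theta^T) = theta^T by rewrite mulmxA UM mul1mx.
  move/(congr1 (fun A : 'cV[R]_d => A i ord0)); rewrite [RHS]mxE => <-.
  rewrite mxE; apply: eq_bigr => j _; congr (_ * _).
  by rewrite mxE; apply: eq_bigr => k _; rewrite !mxE.
apply: le_trans (ler_norm_sum _ _ _) _.
have -> : d%:R * (B * e) = \sum_(j < d) B * e.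
  by rewrite sumr_const card_ord mulr_natl.
by apply: ler_sum => j _; rewrite normrM ler_pM// thee.
Qed.

Lemma fourier_level_sets d K a b (gam : R -> 'rV[R]_d) (chi : R -> R[i]) :
  a < b -> smooth_on `[a, b] gam -> smooth_cplx chi ->
  finite_type `[a, b] gam \/ polynomial_curve `[a, b] gam ->
  (forall t, a <= t <= b ->
    row_free (\matrix_(i < K) deriven_on `[a, b] i.+1 gam t)) ->
  let f r theta := ComplexField.Normc.normc (fourier `[a, b] gam chi (r *: theta)) in
  exists C, [/\ 0 < C,
    forall (theta : 'rV[R]_d) r, sphere theta -> 1 <= r -> f r theta <= C,
    forall m, (m <= K)%N -> exists2 V, 0 <= V & forall r lam, 1 <= r -> 1 <= lam ->
      exists E, [/\ measurable E,
        (sphere_measure E <=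
          (V * (r^-1 ^+ m * lam ^+ (\sum_(k < m) k.+1).+1))%:E)%E &
        forall theta, sphere theta -> f r theta <= C / lam \/ E theta] &
    K = d -> forall (theta : 'rV[R]_d) r lam, sphere theta -> 1 <= r -> 1 <= lam ->
      C * lam ^+ d <= r -> f r theta <= C / lam].
Proof.
move=> ab sgam schi ftp fM f.
have [C C0 HC] := fourier_dichotomy K ab sgam schi ftp.
have [u [B [B0 Hu]]] := derivatives_dual ab sgam fM.
(* The added term contradicts [dotp theta theta = 1] when [K = d] and [C' * lam ^+ d <= r]. *)
pose C' := C + d%:R * d%:R * B * C.
have CC' : C <= C' by rewrite lerDl !mulr_ge0// ltW.
exists C'; split.
- exact: lt_le_trans CC'.
- by move=> theta r St r1; have [/le_trans->] := HC theta r St r1.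
- move=> m mK; have [V V0 HV] := @sphere_measure_slabs R d m B B0.
  exists ((b - a + 1) * V * C ^+ m).
    by rewrite !mulr_ge0 ?exprn_ge0 ?(ltW C0)// addr_ge0// subr_ge0 ltW.
  move=> r lam r1 lam1.
  have r0 : 0 < r := lt_le_trans ltr01 r1.
  have lam0 : 0 < lam := lt_le_trans ltr01 lam1.
  (* As [lam >= 1], the grid has [N.+1 <= (b - a + 1) * lam] points; this is the extra factor [lam]
     in the measure bound. *)
  pose N := Num.truncn ((b - a) * lam).
  have ba0 : 0 <= (b - a) * lam by rewrite mulr_ge0 ?subr_ge0 ?ltW.
  pose t (i : nat) := a + i%:R / lam.
  have tI i : (i < N.+1)%N -> a <= t i <= b.
    rewrite ltnS => iN; rewrite lerDl divr_ge0 ?(ltW lam0)//= -lerBrDl.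
    rewrite ler_pdivrMr//; apply: (@le_trans _ _ N%:R); first by rewrite ler_nat.
    by rewrite truncn_le.
  pose w i k := deriven_on `[a, b] k.+1 gam (t i).
  pose eps k := C * r^-1 * lam ^+ k.+1.
  have eps0 k : 0 < eps k by rewrite !mulr_gt0 ?invr_gt0 ?exprn_gt0.
  exists (\big[setU/set0]_(i < N.+1) slabs (w i) eps m); split.
  + by apply: bigsetU_measurable => i _; exact: measurable_slabs.
  + apply: (@le_trans _ _ (\sum_(i < N.+1) sphere_measure (slabs (w i) eps m))%E).
      apply: (@Boole_inequality _ _ _ (@sphere_measure R d)
        (fun i => slabs (w i) eps m)) => i _.
      exact: measurable_slabs.
    have S i : (i < N.+1)%N ->
        (sphere_measure (slabs (w i) eps m) <= (V * \prod_(k < m) eps k)%:E)%E.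
      move=> /tI/Hu[wu uB _]; apply: (HV _ (u (t i))) => //.
      * by move=> i' j im jm; apply: wu; exact: leq_trans mK.
      * by move=> j i' jm; apply: uB; exact: leq_trans mK.
    apply: (@le_trans _ _ (\sum_(i < N.+1) (V * \prod_(k < m) eps k)%:E)%E).
      by apply: lee_sum => i _; exact: S.
    rewrite sumEFin lee_fin sumr_const card_ord -[leLHS]mulr_natl.
    have -> : \prod_(k < m) eps k = C ^+ m * (r^-1 ^+ m * lam ^+ (\sum_(k < m) k.+1)).
      rewrite big_split/= prodr_const card_ord exprMn -mulrA prodrXr.
      by [].
    rewrite exprS; set X := lam ^+ _.
    have -> : (b - a + 1) * V * C ^+ m * (r^-1 ^+ m * (lam * X)) =
      ((b - a + 1) * lam) * (V * (C ^+ m * (r^-1 ^+ m * X))) by ring.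
    apply: ler_wpM2r.
      rewrite mulr_ge0// mulr_ge0 ?exprn_ge0 ?(ltW C0)//.
      by rewrite mulr_ge0 ?exprn_ge0 ?invr_ge0 ?(ltW r0) ?(ltW lam0).
    rewrite -natr1 mulrDl mul1r lerD// /N truncn_le//.
  + move=> theta St; have [_ /(_ lam lam1)[fC|[s Is Hs]]] := HC theta r St r1.
      left; apply: le_trans fC _; rewrite ler_wpM2r// invr_ge0 ltW//.
    (* The last grid point not beyond [s], at distance at most [1 / lam]. *)
    right; pose i := Num.truncn ((s - a) * lam).
    have sa0 : 0 <= (s - a) * lam by rewrite mulr_ge0 ?(ltW lam0)// subr_ge0; case/andP: Is.
    have iN : (i < N.+1)%N.
      rewrite ltnS /i /N truncn_ge_nat// (le_trans (_ : _ <= (s - a) * lam))//.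
        by rewrite truncn_le.
      by rewrite ler_wpM2r ?(ltW lam0)// lerB//; case/andP: Is.
    rewrite -(bigcup_mkord N.+1 (fun i => slabs (w i) eps m)); exists i => // k km.
    have ts : `|t i - s| <= lam^-1.
      have := truncn_itv sa0; rewrite -/i => /andP[i1 i2].
      have -> : t i - s = (i%:R - (s - a) * lam) / lam.
        by rewrite /t mulrBl mulfK ?gt_eqF//; ring.
      rewrite normrM normfV (gtr0_norm lam0) ler_piMl ?invr_ge0 ?(ltW lam0)//.
      rewrite ler0_norm ?subr_le0// opprB lerBlDl natr1.
      exact: ltW.
    have := Hs (t i) (tI i iN) ts k.+1; rewrite ltnS (leq_trans km mK) => /(_ isT).
    by rewrite /eps mulrAC ler_pdivlMr// mulrC.
- move=> Kd theta r lam St r1 lam1 Cr.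
  have r0 : 0 < r := lt_le_trans ltr01 r1.
  have lam0 : 0 < lam := lt_le_trans ltr01 lam1.
  have [_ /(_ lam lam1)[fC|[s Is Hs]]] := HC theta r St r1.
    by apply: le_trans fC _; rewrite ler_wpM2r// invr_ge0 ltW//.
  exfalso; have [_ _ /(_ Kd theta (C * lam ^+ d / r))] := Hu s Is.
  case/(_ _)/wrap => [k kK|H].
    rewrite ler_pdivlMr// mulrC.
    apply: le_trans (Hs s Is _ k.+1 kK) _; first by rewrite subrr normr0 invr_ge0 ltW.
    by rewrite ler_wpM2l ?(ltW C0)// ler_weXn2l// -Kd.
  have : `|dotp theta theta| <= d%:R * (d%:R * (B * (C * lam ^+ d / r)) * 1).
    by apply: dotp_le => // i; exact: sphere_coord.
  rewrite dotp_enorm (St : enorm theta = 1) expr1n normr1.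
  have -> : d%:R * (d%:R * (B * (C * lam ^+ d / r)) * 1) =
      d%:R * d%:R * B * C * lam ^+ d / r by ring.
  rewrite ler_pdivlMr// mul1r leNgt => /negP; apply.
  apply: lt_le_trans Cr; rewrite /C' mulrDl ltrDr.
  by rewrite mulr_gt0 ?exprn_gt0.
Qed.

End level_sets.

(** * Summation over dyadic levels *)

Section layer_cake.
Context d (T : measurableType d) (R : realType).
Variable mu : {measure set T -> \bar R}.

(* Unlike [ge0_le_integral], no measurability: the integral of a nonnegative
   function is a supremum over the simple functions below it. *)
Lemma le_integral_nonmeasurable (f g : T -> \bar R) :
  (forall x, 0 <= f x)%E -> (forall x, f x <= g x)%E ->
  (\int[mu]_x f x <= \int[mu]_x g x)%E.
Proof.
move=> f0 fg; have g0 x : (0 <= g x)%E := le_trans (f0 x) (fg x).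
rewrite !ge0_integralTE//; apply: le_ereal_sup => _ [h hf <-].
by exists h => // x; exact: le_trans (fg x).
Qed.

(** Descent through the levels: either [f x] is below level [j] and the descent goes on, or [x] lies
    in [E j] and the bound from level [j.+1] is kept. Hence [j.+1] in the weight of [E j]. *)
Lemma layer_cake_bound (S : set T) (f : T -> R) (M q C al : R) (J : nat)
    (E : nat -> set T) (v : nat -> R) :
  measurable S -> mu (~` S) = 0%E -> (mu setT <= M%:E)%E ->
  0 < q -> 0 <= C -> 0 <= al ->
  (forall x, 0 <= f x) ->
  (forall j, (j < J)%N -> measurable (E j) /\ (mu (E j) <= (v j)%:E)%E) ->
  (forall x, S x -> f x <= C * (2 ^+ J * al)) ->
  (forall x j, S x -> (j < J)%N -> f x <= C * (2 ^+ j * al) \/ E j x) ->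
  (\int[mu]_x (`|(f x)%:E| `^ q) <= ((C * al) `^ q * M +
    \sum_(j < J) (C * (2 ^+ j.+1 * al)) `^ q * v j)%:E)%E.
Proof.
move=> mS S0 muT q0 C0 al0 f0 Ev fJ fE.
pose c (j : nat) : R := (C * (2 ^+ j.+1 * al)) `^ q.
have c0 j : 0 <= c j by exact: powR_ge0.
have fq x k : f x <= C * (2 ^+ k * al) ->
    (forall j, (j < k)%N -> f x <= C * (2 ^+ j * al) \/ E j x) ->
    f x `^ q <= (C * al) `^ q + \sum_(j < k) c j * \1_(E j) x.
  elim: k => [|k IH] fk fEk.
    rewrite big_ord0 addr0 ge0_ler_powR ?nnegrE ?f0 ?mulr_ge0 ?(ltW q0)//.
    by rewrite expr0 mul1r in fk.
  have s0 : 0 <= \sum_(j < k) c j * \1_(E j) x by apply: sumr_ge0 => j _; rewrite mulr_ge0.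
  rewrite big_ord_recr/= addrA.
  have [fx|Ex] := fEk k (ltnSn k).
    apply: le_trans (IH fx (fun j jk => fEk j (ltnW jk))) _.
    by rewrite lerDl mulr_ge0.
  rewrite indicE mem_set// mulr1.
  have fc : f x `^ q <= c k.
    by rewrite /c ge0_ler_powR ?nnegrE ?(ltW q0)// ?mulr_ge0 ?exprn_ge0.
  by rewrite (le_trans fc)// lerDr addr_ge0// powR_ge0.
(* Outside [S] nothing bounds [f]; the indicator of the complement gets weight [+oo], which its
   measure 0 cancels. *)
pose K (j : nat) : \bar R :=
  match j with 0 => ((C * al) `^ q)%:E | 1 => +oo%E | j.+2 => (c j)%:E end.
pose F (j : nat) : set T := match j with 0 => setT | 1 => ~` S | j.+2 => E j end.
have K0 j : (0 <= K j)%E by case: j => [|[|j]]//=; rewrite lee_fin ?powR_ge0.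
have mF j : (j < J.+2)%N -> measurable (F j).
  by case: j => [|[|j]]//= => [_|jJ]; [exact: measurableC|have [] := Ev j jJ].
apply: (@le_trans _ _ (\int[mu]_x \sum_(j < J.+2) (K j * (\1_(F j) x)%:E))%E).
  apply: le_integral_nonmeasurable => x; first exact: poweR_ge0.
  rewrite abse_EFin ger0_norm// poweR_EFin !big_ord_recl/=.
  have -> : (\sum_(i < J) (c i)%:E * (\1_(E i) x)%:E)%E =
      (\sum_(i < J) c i * \1_(E i) x)%:E by rewrite -sumEFin.
  rewrite indicE mem_set// mule1.
  have [Sx|nSx] := pselect (S x).
    rewrite indicE memNset; last by apply.
    rewrite mule0 add0e -EFinD lee_fin; apply: fq; first exact: fJ.
    by move=> j jJ; exact: fE.
  by rewrite indicE mem_set// mule1 addye// addey// leey.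
rewrite ge0_integral_sum//; last 2 first.
- move=> i; apply: measurable_funeM; apply/measurable_EFinP.
  by apply: measurable_indic; exact: mF.
- by move=> i x _; rewrite mule_ge0// lee_fin.
rewrite (eq_bigr (fun i : 'I_J.+2 => K i * mu (F i))%E); last first.
  move=> i _.
  have m1 : measurable_fun setT (fun x => (\1_(F i) x)%:E : \bar R).
    by apply/measurable_EFinP; apply: measurable_indic; exact: mF.
  have p1 x : [set: T] x -> (0 <= (\1_(F i) x)%:E :> \bar R)%E by rewrite lee_fin.
  rewrite (ge0_integralZl mu measurableT m1 p1 (K0 i)).
  by rewrite integral_indic ?setIT//; exact: mF.
rewrite !big_ord_recl/= S0 mule0 add0e EFinD; apply: leeD.
  by rewrite EFinM; apply: lee_wpmul2l => //; rewrite lee_fin powR_ge0.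
rewrite -sumEFin; apply: lee_sum => i _; rewrite EFinM.
by apply: lee_wpmul2l; [rewrite lee_fin|have [] := Ev i (ltn_ord i)].
Qed.

End layer_cake.

Section dyadic_sums.
Context {R : realType}.
Implicit Types (al tau p x y : R).

Lemma ler_powR_neg p x y : p <= 0 -> 0 < x -> x <= y -> y `^ p <= x `^ p.
Proof.
move=> p0 x0 xy; rewrite -[p]opprK !(powRN _ (- p)) lef_pV2 ?posrE ?powR_gt0//.
  by rewrite ge0_ler_powR ?nnegrE ?oppr_ge0// ltW// (lt_le_trans x0).
exact: lt_le_trans xy.
Qed.

Lemma powR2_gt1 p : 0 < p -> 1 < 2 `^ p :> R.
Proof.
move=> p0; have := @gt0_ltr_powR R p p0 1 2.
by rewrite !nnegrE powR1 ltr1n; apply.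
Qed.

(** The induction carries the sharper bound with [Num.min (2 ^+ J * al) (2 * tau)], the first dyadic
    point not yet summed, cut off at [2 * tau]. *)
Lemma dyadic_sum_below al tau p J : 0 < p -> 0 < al -> 0 < tau ->
  \sum_(j < J) (if 2 ^+ j * al < tau then (2 ^+ j * al) `^ p else 0) <=
    (2 * tau) `^ p / (2 `^ p - 1).
Proof.
move=> p0 al0 tau0; set c := 2 `^ p - 1.
have c0 : 0 < c by rewrite subr_gt0 powR2_gt1.
have x0 j : 0 < 2 ^+ j * al by rewrite mulr_gt0 ?exprn_gt0.
have mono x y : 0 <= x -> x <= y -> x `^ p / c <= y `^ p / c.
  move=> x0' xy; rewrite ler_wpM2r ?invr_ge0 ?(ltW c0)//.
  by rewrite ge0_ler_powR ?nnegrE ?(ltW p0)// (le_trans x0').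
apply: (@le_trans _ _ (Num.min (2 ^+ J * al) (2 * tau) `^ p / c)); last first.
  by apply: mono; [rewrite le_min !mulr_ge0 ?(ltW al0) ?(ltW tau0)|rewrite ge_min lexx orbT].
elim: J => [|J IH]; first by rewrite big_ord0 divr_ge0 ?powR_ge0 ?(ltW c0).
rewrite big_ord_recr/= exprS -mulrA; set x := 2 ^+ J * al in IH *.
have xp : 0 < x := x0 J.
have m0 : 0 <= Num.min x (2 * tau).
  by rewrite le_min (ltW xp) mulr_ge0// ltW.
have [xt|tx] := ltP x tau; last first.
  rewrite addr0 (le_trans IH)//; apply: mono => //.
  rewrite le_min !ge_min lexx orbT andbT.
  by rewrite ler_peMl ?(ltW xp)// ler1n.
rewrite (min_idPl _) ?ler_pM2l ?(ltW xt)//.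
apply: (@le_trans _ _ (x `^ p / c + x `^ p)).
  by rewrite lerD2r (le_trans IH)//; apply: mono; rewrite // ge_min lexx.
rewrite powRM ?(ltW xp)//.
have -> : 2 `^ p = c + 1 by rewrite /c subrK.
by rewrite mulrDl mul1r mulrDl mulrAC divff ?gt_eqF// mul1r addrC.
Qed.

(** The induction subtracts the tail that starts at [Num.max (2 ^+ J * al) tau]. *)
Lemma dyadic_sum_above al tau p J : p < 0 -> 0 < al -> 0 < tau ->
  \sum_(j < J) (if tau <= 2 ^+ j * al then (2 ^+ j * al) `^ p else 0) <=
    tau `^ p / (1 - 2 `^ p).
Proof.
move=> p0 al0 tau0; set c := 1 - 2 `^ p.
have c0 : 0 < c.
  rewrite subr_gt0 -[p]opprK powRN invf_lt1 ?powR_gt0// powR2_gt1//.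
  by rewrite oppr_gt0.
have x0 j : 0 < 2 ^+ j * al by rewrite mulr_gt0 ?exprn_gt0.
apply: (@le_trans _ _ ((tau `^ p - Num.max (2 ^+ J * al) tau `^ p) / c)); last first.
  by rewrite ler_wpM2r ?invr_ge0 ?(ltW c0)// gerBl powR_ge0.
have mono y : tau <= y -> 0 <= (tau `^ p - y `^ p) / c.
  by move=> ty; rewrite divr_ge0 ?(ltW c0)// subr_ge0 ler_powR_neg// ltW.
elim: J => [|J IH]; first by rewrite big_ord0 mono// le_max lexx orbT.
rewrite big_ord_recr/= exprS -mulrA; set x := 2 ^+ J * al in IH *.
have xp : 0 < x := x0 J.
have [tx|xt] := leP tau x; last first.
  rewrite addr0 (le_trans IH)// (max_idPr _) ?(ltW xt)// subrr mul0r.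
  by rewrite mono// le_max lexx orbT.
rewrite (max_idPl _) in IH; last by [].
rewrite (max_idPl _); last first.
  by rewrite (le_trans tx)// ler_peMl ?(ltW xp)// ler1n.
apply: (@le_trans _ _ ((tau `^ p - x `^ p) / c + x `^ p)).
  by rewrite lerD2r.
rewrite powRM ?(ltW xp)//.
have -> : 2 `^ p = 1 - c by rewrite /c opprB addrC subrK.
clear IH mono; move: (x `^ p) (tau `^ p) c c0 => X T c c0.
have c1 : c != 0 by rewrite gt_eqF.
by rewrite le_eqVlt; apply/orP; left; apply/eqP; field.
Qed.

(** This is [q_m] as a natural number: [1 + ... + m] from the widths of the slabs, one more from the
    number of grid points. *)
Definition level_exponent (m : nat) : nat := (\sum_(k < m) k.+1).+1.

Lemma level_exponentE m : (level_exponent m)%:R = q_ R m.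
Proof.
rewrite /q_ !natrD natrX /level_exponent -natr1.
elim: m => [|m IH]; first by rewrite big_ord0; field.
rewrite big_ord_recr/= natrD addrAC IH -[m.+1%:R]natr1.
by move: (m%:R : R) => x; field.
Qed.

End dyadic_sums.

(** * From level sets to integrals over the sphere *)

Section decay_from_level_sets.
Context {R : realType} (d : nat).
Local Notation mu := (@sphere_measure R d).
Implicit Types (r lam q A : R).

Lemma measurable_sphere : measurable (@sphere R d).
Proof.
have -> : @sphere R d = @enorm R d @^-1` [set 1] by [].
by rewrite -[X in measurable X]setTI; exact: measurable_enorm.
Qed.

Lemma sphere_measure_setC : mu (~` @sphere R d) = 0%E.
Proof.
rewrite /sphere_measure (_ : _ `&` _ = set0) ?measure0 ?mule0//.
by apply/seteqP; split => // v [/= /andP[v0 _]]; apply; exact: sphere_normalize.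
Qed.

Lemma sphere_measure_setT : exists2 M, 0 <= M & (mu setT <= M%:E)%E.
Proof.
have [V V0 HV] := @sphere_measure_slabs R d 0 0 (lexx 0).
exists V => //; apply: (@le_trans _ _ (mu (slabs (fun=> 0) (fun=> 1) 0))).
  by rewrite le_measure ?inE//; exact: measurable_slabs.
have := HV (fun=> 0) (fun=> 0) (fun=> 1); rewrite big_ord0 mulr1.
by apply.
Qed.

Definition level_sets (f : R -> 'rV[R]_d -> R) C m V :=
  forall r lam, 1 <= r -> 1 <= lam -> exists E, [/\ measurable E,
    (mu E <= (V * (r^-1 ^+ m * lam ^+ level_exponent m))%:E)%E &
    forall theta, sphere theta -> f r theta <= C / lam \/ E theta].

Lemma level_sets_le f C m V V' : V <= V' -> level_sets f C m V ->
  level_sets f C m V'.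
Proof.
move=> VV' H r lam r1 lam1; have [E [mE ME fE]] := H r lam r1 lam1.
exists E; split => //; apply: le_trans ME _.
rewrite lee_fin ler_wpM2r// mulr_ge0 ?exprn_ge0 ?invr_ge0//.
  by rewrite (le_trans ler01).
by rewrite (le_trans ler01).
Qed.

(** The number of slabs [m] may vary with the level. Since [J] is the first index whose level
    reaches [A <= 1], every level [x] in the sum has [1 / x >= 1], as [level_sets] demands. *)
Lemma level_integral (f : R -> 'rV[R]_d -> R) C V q A r (m : R -> nat) M :
  0 < C -> 0 <= V -> 0 < q -> 0 < A <= 1 -> 1 <= r ->
  (mu setT <= M%:E)%E ->
  (forall theta, 0 <= f r theta) ->
  (forall theta, sphere theta -> f r theta <= C * A) ->
  (forall x, level_sets f C (m x) V) ->
  let al := r `^ (- 2^-1) in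
  exists J, (forall j, (j < J)%N -> 2 ^+ j * al < A) /\
  (\int[mu]_theta (`|(f r theta)%:E| `^ q) <= ((C * al) `^ q * M +
    (2 * C) `^ q * V * \sum_(j < J) (let x := 2 ^+ j * al in
      r^-1 ^+ (m x) * x `^ (q - (level_exponent (m x))%:R)))%:E)%E.
Proof.
move=> C0 V0 q0 /andP[A0 A1] r1 muM f0 fA H al.
have r0 : 0 < r := lt_le_trans ltr01 r1.
have al0 : 0 < al by rewrite powR_gt0.
have exJ : exists j, A <= 2 ^+ j * al.
  exists (Num.truncn (A / al)).+1; rewrite -ler_pdivrMr//.
  apply: (@le_trans _ _ (Num.truncn (A / al)).+1%:R).
    by rewrite ltW// truncnS_gt.
  by rewrite -natrX ler_nat ltnW// ltn_expl.
have [J AJ Jmin] := ex_minnP exJ.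
have JA j : (j < J)%N -> 2 ^+ j * al < A.
  by move=> jJ; rewrite ltNge; apply/negP => /Jmin; rewrite leqNgt jJ.
exists J; split => //.
have x0 j : 0 < 2 ^+ j * al by rewrite mulr_gt0 ?exprn_gt0.
pose x (j : nat) := 2 ^+ j * al.
pose v (j : nat) := V * (r^-1 ^+ m (x j) * (x j)^-1 ^+ level_exponent (m (x j))).
have /choice[E HE] : forall j, exists E, (j < J)%N -> [/\ measurable E,
    (mu E <= (v j)%:E)%E &
    forall theta, sphere theta -> f r theta <= C * x j \/ E theta].
  move=> j; have [jJ|] := ltnP j J; last by exists set0.
  have xl1 : 1 <= (x j)^-1 by rewrite invf_ge1 ?x0// (le_trans (ltW (JA j jJ))).
  have [E [mE ME fE]] := H (x j) r (x j)^-1 r1 xl1.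
  by exists E => _; split => // theta /fE; rewrite invrK.
apply: le_trans (layer_cake_bound (S := @sphere R d) (f := f r) (J := J) (E := E)
  (v := v) (M := M) (C := C) (al := al) measurable_sphere sphere_measure_setC muM
  q0 (ltW C0) (ltW al0) f0 _ _ _) _.
- by move=> j /HE[].
- move=> theta St; apply: le_trans (fA theta St) _.
  by rewrite ler_pM2l.
- by move=> theta j St jJ; have [_ _] := HE j jJ; exact.
rewrite lee_fin lerD2l mulr_sumr; apply: ler_sum => j _.
rewrite exprS (_ : C * (2 * 2 ^+ j * al) = (2 * C) * x j); last by rewrite /x; ring.
rewrite powRM ?mulr_ge0 ?(ltW C0) ?exprn_ge0 ?(ltW al0)// /v/=.
rewrite powRB; last by rewrite (gt_eqF (x0 j)) implybT.
rewrite powR_mulrn ?(ltW (x0 j))// -/(x j) -!exprVn.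
move: ((2 * C) `^ q) (x j `^ q) (r^-1 ^+ _) ((x j)^-1 ^+ _) => u w y z.
by rewrite [leLHS](_ : _ = u * V * (y * (w * z)))//; ring.
Qed.

End decay_from_level_sets.

Section decay_rates.
Context {R : realType} (d : nat).
Local Notation mu := (@sphere_measure R d).
Implicit Types (r lam q : R).

Lemma level_exponentR m :
  (level_exponent m)%:R = (m%:R ^+ 2 + m%:R + 2) / 2 :> R.
Proof. by rewrite level_exponentE /q_ !natrD natrX. Qed.

Lemma exprV_powR r n (y z : R) : 0 < r ->
  r^-1 ^+ n * (r `^ z) `^ y = r `^ (- n%:R + z * y).
Proof.
move=> r0; rewrite -powRrM exprVn -powR_invn ?(ltW r0)// -powRD//.
by rewrite (gt_eqF r0) implybT.
Qed.

(** The common decay exponent of [r^-k x^(q - q_k)] and [r^-(k-1) x^(q - q_(k-1))] at the level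
    [x = r^(-1/k)]. *)
Definition term_exponent k q : R :=
  q / k%:R + (k%:R ^+ 2 - k%:R - 2) / (2 * k%:R).

Lemma term_exponentE k q : q != 0 -> term_exponent k q = q * sigma_term k q%:E.
Proof.
move=> q0; rewrite /sigma_term /recip inver (negbTE q0)/= mulrDr /term_exponent.
by rewrite mulrCA mulfV// mulr1.
Qed.

Variables (f : R -> 'rV[R]_d -> R) (C : R).
Hypothesis C0 : 0 < C.
Hypothesis f0 : forall r theta, 0 <= f r theta.

Lemma base_term r q : 0 < r ->
  (C * r `^ (- 2^-1)) `^ q = C `^ q * r `^ (- (q / 2)).
Proof.
move=> r0; rewrite powRM ?powR_ge0 ?(ltW C0)// -powRrM.
by congr (_ * r `^ _); rewrite mulNr mulrC.
Qed.

Lemma decay_above_critical m V q (A : R -> R) : 0 <= V -> 0 < q ->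
  level_sets f C m V -> (level_exponent m)%:R < q ->
  (forall r, 1 <= r -> 0 < A r <= 1) ->
  (forall r theta, 1 <= r -> sphere theta -> f r theta <= C * A r) ->
  exists2 D, 0 <= D & forall r, 1 <= r ->
    (\int[mu]_theta (`|(f r theta)%:E| `^ q) <= (D * (r `^ (- (q / 2)) +
      r^-1 ^+ m * (A r) `^ (q - (level_exponent m)%:R)))%:E)%E.
Proof.
move=> V0 q0 lsm eq A01 fA; have [M M0 HM] := @sphere_measure_setT R d.
set p := q - _; have p0 : 0 < p by rewrite subr_gt0.
pose c := 2 `^ p / (2 `^ p - 1) : R.
have c0 : 0 <= c by rewrite divr_ge0 ?powR_ge0// subr_ge0 ltW// powR2_gt1.
have B0 : 0 <= C `^ q * M by rewrite mulr_ge0 ?powR_ge0.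
have W0 : 0 <= (2 * C) `^ q * V by rewrite mulr_ge0 ?powR_ge0.
have Wc0 : 0 <= (2 * C) `^ q * V * c := mulr_ge0 W0 c0.
exists (C `^ q * M + (2 * C) `^ q * V * c).
  exact: addr_ge0.
move=> r r1; have r0 : 0 < r := lt_le_trans ltr01 r1.
have /andP[A0 A1] := A01 r r1.
have [J [JA HJ]] := level_integral (m := fun=> m) C0 V0 q0 (A01 r r1) r1 HM
  (f0 r) (fun theta => @fA r theta r1) (fun=> lsm).
apply: le_trans HJ _; rewrite lee_fin base_term//.
rewrite mulrDr lerD//.
  by rewrite mulrAC ler_wpM2r ?powR_ge0// lerDl.
set al := r `^ (- 2^-1) in JA *; have al0 : 0 < al by rewrite powR_gt0.
rewrite /= -mulr_sumr.
have -> : \sum_(j < J) (2 ^+ j * al) `^ p =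
    \sum_(j < J) (if 2 ^+ j * al < A r then (2 ^+ j * al) `^ p else 0).
  by apply: eq_bigr => j _; rewrite JA.
apply: (@le_trans _ _ ((2 * C) `^ q * V * (r^-1 ^+ m * ((2 * A r) `^ p / (2 `^ p - 1))))).
  rewrite ler_wpM2l// ler_wpM2l ?exprn_ge0 ?invr_ge0 ?(ltW r0)//.
  exact: dyadic_sum_below.
rewrite [(2 * A r) `^ p]powRM ?(ltW A0)//.
rewrite (_ : (2 * C) `^ q * V * (r^-1 ^+ m * (2 `^ p * A r `^ p / (2 `^ p - 1))) =
  ((2 * C) `^ q * V * c) * (r^-1 ^+ m * A r `^ p)).
  rewrite ler_wpM2r ?mulr_ge0 ?exprn_ge0 ?invr_ge0 ?powR_ge0 ?(ltW r0)//.
  by rewrite lerDr.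
by rewrite /c; move: (_ `^ q) (r^-1 ^+ m) (2 `^ p) (A r `^ p) => *; ring.
Qed.

Lemma decay_critical k V q : 0 <= V -> 0 < q ->
  level_sets f C k V -> q = (level_exponent k)%:R ->
  (forall r theta, 1 <= r -> sphere theta -> f r theta <= C) ->
  exists2 D, 0 <= D & forall r, 2 <= r ->
    (\int[mu]_theta (`|(f r theta)%:E| `^ q) <= (D * ((r `^ (- (q / 2)) +
      r^-1 ^+ k) * ln r))%:E)%E.
Proof.
move=> V0 q0 lsk eq fC; have [M M0 HM] := @sphere_measure_setT R d.
have ln2 : 0 < ln 2 :> R by rewrite ln_gt0// ltr1n.
exists (C `^ q * M / ln 2 + (2 * C) `^ q * V * (3 / 2 / ln 2)).
  by rewrite addr_ge0 ?mulr_ge0 ?powR_ge0 ?invr_ge0 ?(ltW ln2).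
move=> r r2; have r1 : 1 <= r by rewrite (le_trans _ r2)// ler1n.
have r0 : 0 < r := lt_le_trans ltr01 r1.
have lnr : ln 2 <= ln r by rewrite ler_ln// posrE.
have [J [JA HJ]] := level_integral (m := fun=> k) C0 V0 q0 (A := 1)
  (introT andP (conj ltr01 (lexx 1))) r1 HM
  (f0 r) (fun theta St => le_trans (fC r theta r1 St) (eq_ind_r (fun x => C <= x) (lexx C) (mulr1 C)))
  (fun=> lsk).
apply: le_trans HJ _; rewrite lee_fin base_term//=.
have -> : \sum_(j < J) (r^-1 ^+ k * (2 ^+ j * r `^ (- 2^-1)) `^ (q - (level_exponent k)%:R))
    = J%:R * r^-1 ^+ k.
  rewrite (eq_bigr (fun=> r^-1 ^+ k)); last first.
    by move=> j _; rewrite eq subrr powRr0 mulr1.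
  by rewrite sumr_const card_ord mulr_natl.
(* Between [r^(-1/2)] and 1 there are at most [1 + log_2 r / 2] dyadic levels, and [r >= 2] absorbs
   the 1. *)
have JL : J%:R <= 3 / 2 / ln 2 * ln r.
  case: J JA => [|J] JA; first by rewrite !mulr_ge0 ?invr_ge0 ?(ltW ln2)// (le_trans (ltW ln2)).
  have := JA J (ltnSn J); rewrite -ltr_pdivlMr ?powR_gt0// div1r -powRN opprK => xJ.
  have : J%:R * ln 2 < 2^-1 * ln r.
    by rewrite -!ln_powR powR_mulrn// ltr_ln ?posrE ?powR_gt0 ?exprn_gt0.
  rewrite -ltr_pdivlMr// => JJ; rewrite -natr1.
  have : 1 <= ln r / ln 2 by rewrite ler_pdivlMr// mul1r.
  have -> : 3 / 2 / ln 2 * ln r = 2^-1 * ln r / ln 2 + ln r / ln 2 by field; rewrite gt_eqF.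
  by move=> h; rewrite lerD// ltW.
have b0 : 0 <= C `^ q * M by rewrite mulr_ge0 ?powR_ge0.
have c0 : 0 <= (2 * C) `^ q * V by rewrite mulr_ge0 ?powR_ge0.
have u0 : 0 <= r `^ (- (q / 2)) by rewrite powR_ge0.
have w0 : 0 <= r^-1 ^+ k by rewrite exprn_ge0// invr_ge0 ltW.
have l1 : 1 <= ln r / ln 2 by rewrite ler_pdivlMr// mul1r.
have l0 : 0 <= ln r by rewrite (le_trans (ltW ln2)).
apply: (@le_trans _ _ (C `^ q * M * (r `^ (- (q / 2)) * (ln r / ln 2)) +
   (2 * C) `^ q * V * (3 / 2 / ln 2 * ln r * r^-1 ^+ k))).
  apply: lerD; last by rewrite ler_wpM2l// ler_wpM2r.
  by rewrite mulrAC ler_wpM2l// ler_peMr.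
have i0 : 0 <= (ln 2)^-1 :> R by rewrite invr_ge0 ltW.
move: (C `^ q * M) ((2 * C) `^ q * V) (r `^ _) (r^-1 ^+ k) (ln r) (ln 2)^-1 b0 c0 u0 w0 l0 i0.
move=> b c u w l i b0 c0 u0 w0 l0 i0.
rewrite -subr_ge0 (_ : _ - _ = b * i * w * l + c * (3 / 2 * i) * u * l).
  by rewrite addr_ge0 ?mulr_ge0.
by field.
Qed.

Lemma decay_subcritical k V q : 0 <= V -> 0 < q -> (2 <= k)%N ->
  level_sets f C k V -> level_sets f C k.-1 V ->
  q < (level_exponent k)%:R -> k = 2 \/ (level_exponent k.-1)%:R < q ->
  (forall r theta, 1 <= r -> sphere theta -> f r theta <= C) ->
  exists2 D, 0 <= D & forall r, 1 <= r ->
    (\int[mu]_theta (`|(f r theta)%:E| `^ q) <= (D * (r `^ (- (q / 2)) +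
      r `^ (- term_exponent k q)))%:E)%E.
Proof.
move=> V0 q0 k2 lsk lsk1 qk qk1 fC; have [M M0 HM] := @sphere_measure_setT R d.
set p := q - (level_exponent k)%:R; have p0 : p < 0 by rewrite subr_lt0.
set p' := q - (level_exponent k.-1)%:R.
(* For [k = 2] the threshold [r^(-1/k)] is the first level, so no level lies below it. This admits
   [q = q_1 = 2]. *)
pose c' : R := if k == 2 then 0 else 2 `^ p' / (2 `^ p' - 1).
pose c : R := (1 - 2 `^ p)^-1.
have c0 : 0 <= c.
  rewrite invr_ge0 subr_ge0 ltW// -[p]opprK powRN invf_lt1 ?powR_gt0// powR2_gt1//.
  by rewrite oppr_gt0.
have c'0 : 0 <= c'.
  rewrite /c'; case: eqP => // /eqP k2'; rewrite divr_ge0 ?powR_ge0// subr_ge0 ltW//.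
  by rewrite powR2_gt1// subr_gt0; case: qk1 k2' => [->|].
have B0 : 0 <= C `^ q * M by rewrite mulr_ge0 ?powR_ge0.
have W0 : 0 <= (2 * C) `^ q * V by rewrite mulr_ge0 ?powR_ge0.
have Wc0 : 0 <= (2 * C) `^ q * V * (c' + c) := mulr_ge0 W0 (addr_ge0 c'0 c0).
exists (C `^ q * M + (2 * C) `^ q * V * (c' + c)); first exact: addr_ge0.
move=> r r1; have r0 : 0 < r := lt_le_trans ltr01 r1.
pose tau := r `^ (- k%:R^-1); have tau0 : 0 < tau by rewrite powR_gt0.
pose m (x : R) := if x < tau then k.-1 else k.
have lsm x : level_sets f C (m x) V by rewrite /m; case: ifP.
have [J [JA HJ]] := level_integral C0 V0 q0 (A := 1)
  (introT andP (conj ltr01 (lexx 1))) r1 HM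
  (f0 r) (fun theta St => le_trans (fC r theta r1 St) (eq_ind_r (fun x => C <= x) (lexx C) (mulr1 C)))
  lsm.
apply: le_trans HJ _; rewrite lee_fin base_term//=.
rewrite mulrDr lerD//.
  by rewrite mulrAC ler_wpM2r ?powR_ge0// lerDl.
apply: (@le_trans _ _ ((2 * C) `^ q * V * ((c' + c) * r `^ (- term_exponent k q)))); last first.
  by rewrite mulrA ler_wpM2r ?powR_ge0// lerDr.
rewrite ler_wpM2l//.
set al := r `^ (- 2^-1); have al0 : 0 < al by rewrite powR_gt0.
have k0 : k%:R != 0 :> R by rewrite pnatr_eq0 -lt0n (ltn_trans _ k2).
have kE : k%:R = k.-1%:R + 1 :> R by rewrite natr1 prednK// (ltn_trans _ k2).
have tE : r^-1 ^+ k * tau `^ p = r `^ (- term_exponent k q).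
  rewrite exprV_powR//; congr (r `^ _); rewrite /p level_exponentR /term_exponent.
  by field.
have tE' : r^-1 ^+ k.-1 * tau `^ p' = r `^ (- term_exponent k q).
  rewrite exprV_powR//; congr (r `^ _); rewrite /p' level_exponentR /term_exponent.
  by rewrite kE in k0 *; field.
have -> : \sum_(j < J) (r^-1 ^+ m (2 ^+ j * al) *
      (2 ^+ j * al) `^ (q - (level_exponent (m (2 ^+ j * al)))%:R)) =
    r^-1 ^+ k.-1 * (\sum_(j < J) (if 2 ^+ j * al < tau then (2 ^+ j * al) `^ p' else 0)) +
    r^-1 ^+ k * (\sum_(j < J) (if tau <= 2 ^+ j * al then (2 ^+ j * al) `^ p else 0)).
  rewrite !mulr_sumr -big_split/=; apply: eq_bigr => j _.
  by rewrite /m; case: ltP => _; rewrite mulr0 ?addr0 ?add0r.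
rewrite mulrDl lerD//; last first.
  rewrite -tE mulrCA ler_wpM2l ?exprn_ge0 ?invr_ge0 ?(ltW r0)// mulrC.
  exact: dyadic_sum_above.
rewrite /c'; case: (eqVneq k 2%N) => [k2'|k2'].
  rewrite mul0r big1 ?mulr0// => j _; case: ltP => //.
  rewrite /tau k2' -/al ltNge ler_peMl ?(ltW al0)//.
  by rewrite exprn_ege1// ler1n.
have p'0 : 0 < p' by rewrite subr_gt0; case: qk1 k2' => [->|].
apply: (@le_trans _ _ (r^-1 ^+ k.-1 * ((2 * tau) `^ p' / (2 `^ p' - 1)))).
  rewrite ler_wpM2l ?exprn_ge0 ?invr_ge0 ?(ltW r0)//.
  exact: dyadic_sum_below.
rewrite powRM ?(ltW tau0)// -tE'.
by rewrite le_eqVlt; apply/orP; left; apply/eqP; rewrite mulrAC mulrCA.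
Qed.

Lemma Lnorm_rate q D s T r : 0 < q -> 0 <= D -> 0 < r -> 0 <= T ->
  (\int[mu]_theta (`|(f r theta)%:E| `^ q) <= (D * (r `^ (- (q * s)) * T))%:E)%E ->
  (Lnorm mu q%:E (fun theta => (f r theta)%:E) <=
    (D `^ q^-1 * (r `^ (- s) * T `^ q^-1))%:E)%E.
Proof.
move=> q0 D0 r0 T0 H; rewrite unlock.
apply: (@le_trans _ _ ((D * (r `^ (- (q * s)) * T))%:E `^ q^-1)%E).
  apply: gt0_ler_poweR => //.
  - by rewrite invr_ge0 ltW.
  - by rewrite in_itv/= leey andbT integral_ge0// => x _; exact: poweR_ge0.
  - by rewrite in_itv/= leey andbT lee_fin !mulr_ge0 ?powR_ge0.
rewrite poweR_EFin !powRM ?mulr_ge0 ?powR_ge0// -powRrM.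
by rewrite mulNr mulrAC mulfV ?gt_eqF// mul1r.
Qed.

Lemma Lnorm_rate1 q D s r : 0 < q -> 0 <= D -> 0 < r ->
  (\int[mu]_theta (`|(f r theta)%:E| `^ q) <= (D * r `^ (- (q * s)))%:E)%E ->
  (Lnorm mu q%:E (fun theta => (f r theta)%:E) <=
    (D `^ q^-1 * r `^ (- s))%:E)%E.
Proof.
move=> q0 D0 r0 H; have := @Lnorm_rate q D s 1 r q0 D0 r0 ler01.
by rewrite !mulr1 powR1 mulr1; apply.
Qed.

End decay_rates.

(** * The three regimes of the exponent *)

Section rates_for_sigma.
Context {R : realType}.
Implicit Types (r q s : R).

Lemma min_sigma_term_le K k (q : \bar R) : (2 <= k <= K)%N ->
  min_sigma_term K q <= sigma_term k q.
Proof.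
move=> /andP[k2 kK]; rewrite /min_sigma_term.
have le_id (l : seq nat) :
    \big[Num.min/sigma_term 2 q]_(j <- l) sigma_term j q <= sigma_term 2 q.
  by elim: l => [|j l IH]; rewrite ?big_nil// big_cons ge_min IH orbT.
move: k2; rewrite leq_eqVlt => /predU1P[<-|k3]; first exact: le_id.
have : k \in index_iota 3 K.+1 by rewrite mem_index_iota k3.
elim: (index_iota _ _) => // j l IH; rewrite inE big_cons ge_min.
by case/predU1P => [->|/IH->]; rewrite ?lexx ?orbT.
Qed.

Lemma sigma_le d K k (q : \bar R) : (2 <= k <= K)%N -> sigma d K q <= sigma_term k q.
Proof.
rewrite /sigma => kK; case: eqP => [<-|_]; first exact: min_sigma_term_le.
by rewrite ge_min min_sigma_term_le ?orbT.
Qed.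

Lemma sigma_term2 (q : \bar R) : sigma_term 2 q = 2^-1.
Proof. by rewrite /sigma_term (_ : 2 ^+ 2 - 2 - 2 = 0) ?mul0r ?addr0//; ring. Qed.

Lemma critical_location n q : (2 <= n)%N -> ~ critical n q%:E ->
  (level_exponent n)%:R < q \/
  exists k, [/\ (2 <= k <= n)%N, q < (level_exponent k)%:R &
    k = 2 \/ (level_exponent k.-1)%:R < q].
Proof.
elim: n => // n IH; rewrite leq_eqVlt => /predU1P[n2|n2] nc.
  have [?|qn|qE] := ltgtP (level_exponent n.+1)%:R q; [by left| |].
    by right; exists n.+1; split => //; [rewrite -n2|left].
  by exfalso; apply: nc; exists n.+1; rewrite /= ?n2 ?leqnn// -qE level_exponentE.
have [||[k [/andP[k2 kn] ? ?]]] := IH n2.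
- move=> [k /= /andP[k2 kn] kq]; apply: nc; exists k => //=.
  by rewrite k2 leqW.
- move=> nq; have [?|qn|qE] := ltgtP (level_exponent n.+1)%:R q; [by left| |].
    by right; exists n.+1; split => //; [rewrite ltnW//= ltnS ltnW|right].
  exfalso; apply: nc; exists n.+1; rewrite /= ?(ltnW n2) ?leqnn//.
  by rewrite -qE level_exponentE.
- by right; exists k; rewrite k2 leqW.
Qed.

Lemma powR_le_rate r s q (e : R) : 1 <= r -> q * s <= e ->
  r `^ (- e) <= r `^ (- (q * s)).
Proof. by move=> r1 qs; rewrite ler_powR// lerN2. Qed.

Variables (d : nat) (f : R -> 'rV[R]_d -> R) (C : R).
Local Notation mu := (@sphere_measure R d).
Local Notation N q r := (Lnorm mu q (fun theta => (f r theta)%:E)).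
Hypothesis C0 : 0 < C.
Hypothesis f0 : forall r theta, 0 <= f r theta.
Hypothesis fC : forall r theta, 1 <= r -> sphere theta -> f r theta <= C.

Lemma Lnorm_oo_le r B : 0 <= B -> (forall theta, sphere theta -> f r theta <= B) ->
  (N +oo%E r <= B%:E)%E.
Proof.
move=> B0 fB.
have H : mu.-negligible (~` [set theta | ((abse \o (fun t => (f r t)%:E)) theta <= B%:E)%E]).
  exists (~` @sphere R d); split.
  - by apply: measurableC; exact: (@measurable_sphere R d).
  - exact: (@sphere_measure_setC R d).
  - by move=> theta /= H St; apply: H; rewrite lee_fin ger0_norm// fB.
rewrite unlock; case: ifPn => _; last by rewrite lee_fin.
exact/ess_supP.
Qed.

Lemma critical_rate k V q s : 0 <= V -> 2 <= q -> (2 <= k)%N ->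
  level_sets f C k V -> q = q_ R k ->
  s <= sigma_term 2 q%:E -> s <= sigma_term k q%:E ->
  exists D, forall r, 2 <= r ->
    (N q%:E r <= (D * (r `^ (- s) * ln r `^ q^-1))%:E)%E.
Proof.
move=> V0 q2 k2 lsk qk s2 sk; have q0 : 0 < q by rewrite (lt_le_trans _ q2).
have [D D0 HD] := decay_critical C0 f0 V0 q0 lsk (etrans qk (esym (level_exponentE k))) fC.
exists ((2 * D) `^ q^-1) => r r2; have r1 : 1 <= r by rewrite (le_trans _ r2)// ler1n.
have r0 : 0 < r := lt_le_trans ltr01 r1.
apply: Lnorm_rate => //; [by rewrite mulr_ge0|by rewrite ln_ge0|].
apply: le_trans (HD r r2) _; rewrite lee_fin.
rewrite (_ : 2 * D * _ = D * ((r `^ (- (q * s)) + r `^ (- (q * s))) * ln r)); last by ring.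
rewrite ler_wpM2l// ler_wpM2r ?ln_ge0// lerD//.
  by apply: powR_le_rate => //; rewrite ler_wpM2l ?(ltW q0)// -(sigma_term2 q%:E).
rewrite exprVn -powR_invn ?(ltW r0)//; apply: powR_le_rate => //.
(* At [q = q_k] the exponent [term_exponent k q] equals [k]. *)
apply: (@le_trans _ _ (term_exponent k q)).
  by rewrite term_exponentE ?gt_eqF// ler_wpM2l// ltW.
have k0 : k%:R != 0 :> R by rewrite pnatr_eq0 -lt0n (ltn_trans _ k2).
rewrite /term_exponent qk -level_exponentE level_exponentR.
by rewrite le_eqVlt; apply/orP; left; apply/eqP; field.
Qed.

Lemma subcritical_rate k V q s : 0 <= V -> 2 <= q -> (2 <= k)%N ->
  level_sets f C k V -> level_sets f C k.-1 V ->
  q < (level_exponent k)%:R -> k = 2 \/ (level_exponent k.-1)%:R < q ->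
  s <= sigma_term 2 q%:E -> s <= sigma_term k q%:E ->
  exists D, forall r, 2 <= r -> (N q%:E r <= (D * r `^ (- s))%:E)%E.
Proof.
move=> V0 q2 k2 lsk lsk1 qk qk1 s2 sk; have q0 : 0 < q by rewrite (lt_le_trans _ q2).
have [D D0 HD] := decay_subcritical C0 f0 V0 q0 k2 lsk lsk1 qk qk1 fC.
exists ((2 * D) `^ q^-1) => r r2; have r1 : 1 <= r by rewrite (le_trans _ r2)// ler1n.
have r0 : 0 < r := lt_le_trans ltr01 r1.
apply: Lnorm_rate1 => //; first by rewrite mulr_ge0.
apply: le_trans (HD r r1) _; rewrite lee_fin.
rewrite (_ : 2 * D * _ = D * (r `^ (- (q * s)) + r `^ (- (q * s)))); last by ring.
rewrite ler_wpM2l// lerD//.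
  by apply: powR_le_rate => //; rewrite ler_wpM2l ?(ltW q0)// -(sigma_term2 q%:E).
apply: powR_le_rate => //.
by rewrite term_exponentE ?gt_eqF// ler_wpM2l// ltW.
Qed.

(* Used with [b = 1/d], [m = d - 1] when [K = d], and with [b = 0], [m = K] when
   [K < d]. *)
Lemma supercritical_rate m V q s b c : 0 <= V -> 2 <= q -> 0 < c ->
  level_sets f C m V -> (level_exponent m)%:R < q ->
  (forall r theta, 1 <= r -> sphere theta ->
    f r theta <= C * Num.min 1 (c * r `^ (- b))) ->
  s <= sigma_term 2 q%:E ->
  q * s <= m%:R + b * (q - (level_exponent m)%:R) ->
  exists D, forall r, 2 <= r -> (N q%:E r <= (D * r `^ (- s))%:E)%E.
Proof.
move=> V0 q2 c0 lsm mq fA s2 sm; have q0 : 0 < q by rewrite (lt_le_trans _ q2).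
have A01 r : 1 <= r -> 0 < Num.min 1 (c * r `^ (- b)) <= 1.
  move=> r1; rewrite ge_min lexx lt_min ltr01 mulr_gt0// powR_gt0//.
  exact: lt_le_trans r1.
have [D D0 HD] := decay_above_critical C0 f0 V0 q0 lsm mq A01 fA.
set p := q - _ in HD sm; have p0 : 0 < p by rewrite subr_gt0.
exists ((D * (1 + c `^ p)) `^ q^-1) => r r2.
have r1 : 1 <= r by rewrite (le_trans _ r2)// ler1n.
have r0 : 0 < r := lt_le_trans ltr01 r1.
apply: Lnorm_rate1 => //; first by rewrite mulr_ge0// addr_ge0// powR_ge0.
apply: le_trans (HD r r1) _; rewrite lee_fin -mulrA ler_wpM2l// mulrDl mul1r.
rewrite lerD//.
  by apply: powR_le_rate => //; rewrite ler_wpM2l ?(ltW q0)// -(sigma_term2 q%:E).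
have /andP[A0 _] := A01 r r1.
apply: (@le_trans _ _ (r^-1 ^+ m * (c * r `^ (- b)) `^ p)).
  rewrite ler_wpM2l ?exprn_ge0 ?invr_ge0 ?(ltW r0)//.
  rewrite ge0_ler_powR ?nnegrE ?(ltW p0) ?(ltW A0)//.
    by rewrite mulr_ge0 ?powR_ge0 ?(ltW c0).
  by rewrite ge_min lexx orbT.
rewrite powRM ?powR_ge0 ?(ltW c0)// mulrCA exprV_powR// ler_wpM2l ?powR_ge0//.
by rewrite mulNr -opprD; exact: powR_le_rate.
Qed.

End rates_for_sigma.

(** * The cases K = d and K < d *)

Unset Implicit Arguments.
Set Strict Implicit.
Set Printing Implicit Defensive.

Theorem theorem1p4 (R : realType) (d K : nat) (a b : R)
    (gamma : R -> 'rV[R]_d) (chi : R -> R[i]) :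
  let I : set R := `[a, b]%classic in
  (3 <= d)%N ->
  a < b ->
  smooth_on I gamma ->
  smooth_cplx chi ->
  closure [set t | chi t != 0] `<=` interior I ->
  finite_type I gamma \/ polynomial_curve I gamma ->
  (forall t, I t -> row_free (\matrix_(i < K) deriven_on I i.+1 gamma t)) ->
  (K = d ->
    (forall q : \bar R, (2%:E <= q)%E -> ~ critical (d - 1) q ->
      exists C : R, forall r, 2 <= r ->
        (G I gamma chi q r <= (C * r `^ (- sigma d d q))%:E)%E)
    /\
    (forall q : \bar R, critical (d - 1) q ->
      exists C : R, forall r, 2 <= r ->
        (G I gamma chi q r <=
          (C * (r `^ (- sigma d d q) * ln r `^ recip q))%:E)%E))
  /\
  ((2 <= K <= d - 1)%N ->
    (forall q : \bar R, (2%:E <= q)%E -> ~ critical K q ->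
      exists C : R, forall r, 2 <= r ->
        (G I gamma chi q r <= (C * r `^ (- sigma d K q))%:E)%E)
    /\
    (forall q : \bar R, critical K q ->
      exists C : R, forall r, 2 <= r ->
        (G I gamma chi q r <=
          (C * (r `^ (- sigma d K q) * ln r `^ recip q))%:E)%E)).
Proof.
move=> I d3 ab sgam schi _ ftp fM.
have fM' t : a <= t <= b ->
    row_free (\matrix_(i < K) deriven_on `[a, b]%classic i.+1 gamma t).
  by move=> It; apply: fM; rewrite /I /= in_itv.
have [C [C0 fC' lsC top]] := fourier_level_sets ab sgam schi ftp fM'.
pose f r (theta : 'rV[R]_d) :=
  ComplexField.Normc.normc (fourier I gamma chi (r *: theta)).
have f0 r theta : 0 <= f r theta.
  by rewrite /f /ComplexField.Normc.normc; case: fourier => x y; exact: sqrtr_ge0.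
have fC r theta : 1 <= r -> sphere theta -> f r theta <= C.
  by move=> r1 St; exact: fC'.
have LS m : (m <= K)%N -> exists2 V, 0 <= V & level_sets f C m V.
  by move=> /lsC[V V0 HV]; exists V.
have LS2 k : (k <= K)%N -> exists V, [/\ 0 <= V, level_sets f C k V &
    level_sets f C k.-1 V].
  move=> kK; have [V V0 HV] := LS k kK.
  have [V' V'0 HV'] := LS k.-1 (leq_trans (leq_pred k) kK).
  exists (V + V'); split; first exact: addr_ge0.
    by apply: level_sets_le HV; rewrite lerDl.
  by apply: level_sets_le HV'; rewrite lerDr.
have recipE (x : R) : 0 < x -> recip x%:E = x^-1.
  by move=> x0; rewrite /recip inver gt_eqF.
have q_ge2 k : (2 <= k)%N -> 2 <= q_ R k.
  case: k => [//|k] _; rewrite -level_exponentE ler_nat /level_exponent.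
  by rewrite big_ord_recl.
have crit k q : (2 <= k <= K)%N -> (q_ R k)%:E = q -> exists D : R, forall r, 2 <= r ->
    (G I gamma chi q r <= (D * (r `^ (- sigma d K q) * ln r `^ recip q))%:E)%E.
  move=> kK <-; have /andP[k2 kK'] := kK; have [V V0 HV] := LS k kK'.
  rewrite recipE ?(lt_le_trans _ (q_ge2 k k2))//.
  apply: (critical_rate C0 f0 fC V0 (q_ge2 k k2) k2 HV erefl).
    by apply: sigma_le; rewrite leqnn (leq_trans k2).
  exact: sigma_le.
have sub (x : R) k : (2 <= k <= K)%N -> 2 <= x -> x < (level_exponent k)%:R ->
    k = 2 \/ (level_exponent k.-1)%:R < x -> exists D : R, forall r, 2 <= r ->
    (G I gamma chi x%:E r <= (D * r `^ (- sigma d K x%:E))%:E)%E.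
  move=> kK x2 xk xk1; have /andP[k2 kK'] := kK; have [V [V0 HV HV']] := LS2 k kK'.
  apply: (subcritical_rate C0 f0 fC V0 x2 k2 HV HV' xk xk1).
    by apply: sigma_le; rewrite leqnn (leq_trans k2).
  exact: sigma_le.
split=> [Kd|/andP[K2 Kd]].
  subst K; split=> [q q2 nc|q [k /= /andP[k2 kd] qE]]; last first.
    by apply: crit qE; rewrite k2 (leq_trans kd)// leq_subr.
  have d0 : d%:R != 0 :> R by rewrite pnatr_eq0 -lt0n (ltn_trans _ d3).
  have dn : (d - 1 <= d)%N by rewrite leq_subr.
  have d1 : (2 <= d - 1)%N by exact: (leq_sub2r 1 d3).
  have s2 (x : \bar R) : sigma d d x <= sigma_term 2 x.
    by apply: sigma_le; rewrite leqnn ltnW.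
  have sd (x : \bar R) : sigma d d x <= sigma_term d x.
    by apply: sigma_le; rewrite leqnn ltnW.
  (* With this [c], [lam = (c * r^(-1/d))^-1] satisfies [C * lam ^+ d <= r], the condition in
     [top]. *)
  pose c := Num.max C 1 `^ d%:R^-1.
  have mC : 0 < Num.max C 1 by rewrite lt_max C0.
  have c0 : 0 < c by rewrite powR_gt0.
  have fA r theta : 1 <= r -> sphere theta ->
      f r theta <= C * Num.min 1 (c * r `^ (- d%:R^-1)).
    move=> r1 St; have r0 : 0 < r := lt_le_trans ltr01 r1.
    have [_|cr] := leP 1 (c * _); first by rewrite mulr1; exact: fC.
    set A := c * _ in cr *; have A0 : 0 < A by rewrite mulr_gt0 ?powR_gt0.
    have := top erefl theta r A^-1 St r1; rewrite invrK; apply.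
      by rewrite invf_ge1 ?ltW.
    rewrite exprVn /A exprMn -!powR_mulrn ?powR_ge0// -!powRrM.
    rewrite mulNr mulVf// !powRr1 ?(ltW mC)// powRN powRr1 ?(ltW r0)//.
    rewrite invfM invrK mulrA ler_piMl ?(ltW r0)//.
    by rewrite ler_pdivrMr// mul1r le_max lexx.
  case: q q2 nc => [x|_ _|//].
    rewrite lee_fin => x2 nc.
    have [xd|[k [/andP[k2 kd] xk xk1]]] := critical_location d1 nc; last first.
      by apply: (sub x k) => //; rewrite k2 (leq_trans kd).
    (* The pointwise bound stops the levels near [r^(-1/d)], where the terms for [d - 1] and [d]
       slabs agree. So [d - 1] slabs already give the exponent of the [d]-th term, and [q_d] is not
       exceptional. *)
    have [V V0 HV] := LS (d - 1)%N dn.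
    apply: (supercritical_rate C0 f0 V0 x2 c0 HV xd fA (s2 _)).
    have x0 : 0 < x by rewrite (lt_le_trans _ x2).
    apply: (@le_trans _ _ (term_exponent d x)).
      by rewrite term_exponentE ?gt_eqF// ler_wpM2l ?(ltW x0).
    rewrite level_exponentR /term_exponent natrB ?(ltn_trans _ d3)//.
    by rewrite le_eqVlt; apply/orP; left; apply/eqP; field.
  exists (C * c) => r r2; have r1 : 1 <= r by rewrite (le_trans _ r2)// ler1n.
  apply: (Lnorm_oo_le f0) => [|theta St].
    by rewrite !mulr_ge0 ?powR_ge0 ?(ltW C0).
  apply: le_trans (fA r theta r1 St) _; rewrite -mulrA ler_wpM2l ?(ltW C0)//.
  rewrite ge_min; apply/orP; right; rewrite ler_wpM2l ?(ltW c0)// ler_powR// lerN2.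
  by have := sd +oo%E; rewrite /sigma_term /recip /= mulr0 addr0.
have dK : (K == d) = false.
  by apply/negbTE; rewrite neq_ltn (leq_ltn_trans Kd)// subn1 ltn_predL (ltn_trans _ d3).
have sK (x : \bar R) : sigma d K x <= K%:R * recip x.
  by rewrite /sigma dK ge_min lexx.
split=> [q q2 nc|q [k /= kK qE]]; last exact: crit qE.
case: q q2 nc => [x|_ _|//].
  rewrite lee_fin => x2 nc.
  have [xK|[k [kK xk xk1]]] := critical_location K2 nc; last exact: (sub x k).
  have [V V0 HV] := LS K (leqnn K).
  apply: (supercritical_rate (b := 0) (c := 1) C0 f0 V0 x2 ltr01 HV xK).
  - by move=> r theta r1 St; rewrite oppr0 powRr0 mulr1 minxx mulr1; exact: fC.
  - by apply: sigma_le; rewrite leqnn K2.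
  - have x0 : 0 < x by rewrite (lt_le_trans _ x2).
    rewrite mul0r addr0 -ler_pdivlMl// mulrC -recipE//; exact: sK.
(* For [q = +oo] the entry [K / q] of the minimum is 0, so [sigma <= 0] and boundedness suffices. *)
exists C => r r2; have r1 : 1 <= r by rewrite (le_trans _ r2)// ler1n.
apply: (Lnorm_oo_le f0) => [|theta St]; first by rewrite mulr_ge0 ?powR_ge0 ?(ltW C0).
apply: (le_trans (fC r theta r1 St)); rewrite ler_peMr ?(ltW C0)//.
rewrite -[leLHS](powRr0 r) ler_powR// oppr_ge0.
by have := sK +oo%E; rewrite /recip /= mulr0.
Qed.
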